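(* If $T={\rm Th}(\mathcal{A}_E)$ for an $E$-combination $\mathcal{A}_E$ (respectively, $T={\rm Th}(\mathcal{A}_P)$ for a $P$-combination $\mathcal{A}_P$) is a countable theory, then $e\text{-}{\rm Sp}(T)\in\omega\cup\{\omega,2^\omega\}$. All values in $\omega\cup\{\omega,2^\omega\}$ are realized as $e\text{-}{\rm Sp}(T)$ in the class of countable theories $T$ of $E$-combinations (respectively, in the class of countable theories $T$ of $P$-combinations).
   Context: All languages are relational; symbols missing from the language of a structure in a family are interpreted by the empty relation, so all structures of a family may be taken in a common language. $E$-combinations. Given a family $(\mathcal{A}_i)_{i\in I}$ of (nonempty, pairwise disjoint) structures, the $E$-combination $\mathcal{A}_E={\rm Comb}_E(\mathcal{A}_i)_{i\in I}$ is the disjoint union of the $\mathcal{A}_i$ (each relation symbol interpreted by the union of its interpretations) expanded by a new binary symbol $E$, interpreted as the equivalence relation whose classes are exactly the universes of the $\mathcal{A}_i$. Every $\mathcal{A}'\equiv\mathcal{A}_E$ is again an $E$-combination, of its restrictions to its $E$-classes. For such $\mathcal{A}'$, $e\text{-}{\rm Sp}(\mathcal{A}')$ is the number of pairwise elementarily non-equivalent structures $\mathcal{B}$ such that $\mathcal{B}$ is the restriction of some $\mathcal{A}''\equiv\mathcal{A}'$ to one of its $E$-classes and $\mathcal{B}$ is not elementarily equivalent to the restriction of $\mathcal{A}'$ to any of its $E$-classes. Then $e\text{-}{\rm Sp}({\rm Th}(\mathcal{A}_E))=\sup\{e\text{-}{\rm Sp}(\mathcal{A}')\mid\mathcal{A}'\equiv\mathcal{A}_E\}$.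 $P$-combinations. Let $(P_i)_{i\in I}$ be nonempty unary predicates (not necessarily disjoint) and $(\mathcal{A}_i)_{i\in I}$ structures such that $P_i$ is the universe of $\mathcal{A}_i$ and the symbols $P_i$ are not in the languages $\Sigma(\mathcal{A}_j)$. Let $\mathcal{A}_P$ be the union $\bigcup_{i\in I}\mathcal{A}_i$ (universe: union of the universes; relations: unions of the relations) expanded by the predicates $P_i$; it is the $P$-combination ${\rm Comb}_P(\mathcal{A}_i)_{i\in I}$ if $\mathcal{A}_i=(\mathcal{A}_P\upharpoonright A_i)\upharpoonright\Sigma(\mathcal{A}_i)$ for all $i\in I$, where $A_i$ is the universe of $\mathcal{A}_i$. Put $p_\infty(x)=\{\neg P_i(x)\mid i\in I\}$. Then $e\text{-}{\rm Sp}({\rm Th}(\mathcal{A}_P))$ is the number of pairwise elementarily non-equivalent (nonempty) restrictions of models $\mathcal{M}\models{\rm Th}(\mathcal{A}_P)$ to the set of realizations of $p_\infty(x)$ in $\mathcal{M}$; in particular it is $0$ if $p_\infty(x)$ is inconsistent with ${\rm Th}(\mathcal{A}_P)$. *)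

(* Defs.v *)
From mathcomp Require Import all_boot.
From mathcomp Require Import boolp classical_sets functions cardinality.

Set Implicit Arguments.
Unset Strict Implicit.
Unset Printing Implicit Defensive.

Local Open Scope classical_set_scope.

(** * Relational first-order logic with equality *)

(* Nullary symbols are excluded: the union of the relations of a family of
   structures is meaningful for arities at least 1 only. *)
Record language := Language {
  sym :> Type;
  arity : sym -> nat;
  arity_gt0 : forall s, 0 < arity s }.

Definition interpretation (L : language) (X : Type) : Type :=
  forall s : L, set ((arity s).-tuple X).

Record structure (L : language) := Structure {
  carrier :> Type;
  carrier_neq0 : inhabited carrier;
  interp : interpretation L carrier }.

(* [formula L n]: formulas whose free variables are among the n variables 'I_n.
   [All] binds variable 0 of its body, as in de Bruijn notation. *)
Inductive formula (L : language) (n : nat) : Type :=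
| Bot : formula L n
| Eq (x y : 'I_n) : formula L n
| Rel (s : L) (xs : (arity s).-tuple 'I_n) : formula L n
| Imp (f g : formula L n) : formula L n
| All (f : formula L n.+1) : formula L n.

Fixpoint sat (L : language) (M : structure L) (n : nat) (f : formula L n) :
    n.-tuple M -> Prop :=
  match f with
  | Bot => fun _ => False
  | Eq x y => fun v => tnth v x = tnth v y
  | Rel s xs => fun v => interp (map_tuple (tnth v) xs)
  | Imp f g => fun v => sat f v -> sat g v
  | All f => fun v => forall a : M, sat f (cons_tuple a v)
  end.

Definition sentence (L : language) : Type := formula L 0.

Definition theory (L : language) : Type := set (sentence L).

Definition Th (L : language) (M : structure L) : theory L :=
  [set f | sat f ([tuple] : 0.-tuple M)].

Definition models (L : language) (M : structure L) (T : theory L) : Prop :=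
  T `<=` Th M.

Definition elem_equiv (L : language) (M N : structure L) : Prop := Th M = Th N.

Lemma restr_inhabited (X : Type) (D : set X) : D !=set0 -> inhabited D.
Proof. by case=> x Dx; exact: (inhabits (exist _ x (mem_set Dx))). Qed.

Definition restr (L : language) (M : structure L) (D : set M)
    (D0 : D !=set0) : structure L :=
  Structure (restr_inhabited D0)
    (fun s (t : (arity s).-tuple D) => interp (map_tuple sval t)).

(** * The values of the e-spectrum *)

Inductive spectrum_value := Finite of nat | Omega | TwoToOmega.

(* A set having the given cardinal. *)
Definition value_type (k : spectrum_value) : Type :=
  match k with
  | Finite n => 'I_n
  | Omega => nat
  | TwoToOmega => nat -> bool
  end.

(** * E-combinations *)

(* [None] is the new binary symbol E. *)
Definition arityE (L : language) (s : option L) : nat :=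
  if s is Some s' then arity s' else 2.

Lemma arityE_gt0 (L : language) (s : option L) : 0 < arityE s.
Proof. by case: s => [s|] //=; exact: arity_gt0. Qed.

Definition langE (L : language) : language := Language (@arityE_gt0 L).

Definition interpE (L : language) (I : Type) (A : I -> structure L) :
    interpretation (langE L) {i : I & A i} :=
  fun s =>
    match s return set ((@arity (langE L) s).-tuple {i : I & A i}) with
    | Some s' => fun t => exists (i : I) (w : (arity s').-tuple (A i)),
        interp w /\ t = map_tuple (existT (fun i => carrier (A i)) i) w
    | None => fun t : 2.-tuple {i : I & A i} =>
        projT1 (tnth t ord0) = projT1 (tnth t ord_max)
    end.

Lemma combE_inhabited (L : language) (I : Type) (A : I -> structure L) :
  inhabited I -> inhabited {i : I & A i}.
Proof. by case=> i; have [a] := carrier_neq0 (A i); exists; exists i. Qed.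

Definition combE (L : language) (I : Type) (I0 : inhabited I)
    (A : I -> structure L) : structure (langE L) :=
  Structure (combE_inhabited A I0) (@interpE L I A).

Definition reductE (L : language) (M : structure (langE L)) : structure L :=
  Structure (carrier_neq0 M) (fun s : L => @interp (langE L) M (Some s)).

Definition classE (L : language) (M : structure (langE L)) (a : M) : set M :=
  [set b | @interp (langE L) M None [tuple a; b]].

(* The theories, without E, of the E-classes of M; two structures are counted
   once when they are elementarily equivalent, so that counting structures up to
   elementary equivalence is counting their theories. *)
Definition class_theories (L : language) (M : structure (langE L)) :
    set (theory L) :=
  [set T | exists (a : M) (a0 : classE a !=set0),
             T = Th (@restr L (reductE M) (classE a) a0)].

Definition new_class_theories (L : language) (M : structure (langE L)) :
    set (theory L) :=
  [set T | (exists N : structure (langE L),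
              elem_equiv N M /\ class_theories N T)
           /\ ~ class_theories M T].

(* e-Sp(T) is the cardinal of K: it is the supremum, i.e. the least cardinal
   upper bound, of the e-Sp(M) for the models M of T. *)
Definition is_eSpE (L : language) (T : theory (langE L)) (K : Type) : Prop :=
  (forall M : structure (langE L), models M T ->
     (new_class_theories M #<= [set: K])%card) /\
  (forall K' : Type,
     (forall M : structure (langE L), models M T ->
        (new_class_theories M #<= [set: K'])%card) ->
     ([set: K] #<= [set: K'])%card).

(** * P-combinations *)

Definition sublang (L : language) (S : set L) : language :=
  @Language S (fun s => arity (sval s)) (fun s => arity_gt0 (sval s)).

(* A family of structures with possibly overlapping universes [dom i] and
   languages [lang i]; U and L are the unions of the universes and of the
   languages. *)
Record Pfamily (L : language) (I U : Type) := PFamily {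
  dom : I -> set U;
  lang : I -> set L;
  dom_neq0 : forall i, dom i !=set0;
  dom_cover : forall x, exists i, dom i x;
  lang_cover : forall s, exists i, lang i s;
  interpI : forall i, interpretation (sublang (lang i)) (dom i) }.

(* [inr i] is the predicate symbol P_i. *)
Definition arityP (L : language) (I : Type) (s : L + I) : nat :=
  if s is inl s' then arity s' else 1.

Lemma arityP_gt0 (L : language) (I : Type) (s : L + I) : 0 < arityP s.
Proof. by case: s => [s|i] //=; exact: arity_gt0. Qed.

Definition langP (L : language) (I : Type) : language :=
  Language (@arityP_gt0 L I).

Definition interpP (L : language) (I U : Type) (A : Pfamily L I U) :
    interpretation (langP L I) U :=
  fun s =>
    match s return set ((@arity (langP L I) s).-tuple U) with
    | inl s' => fun t =>
        exists (i : I) (si : s' \in lang A i) (w : (arity s').-tuple (dom A i)),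
          @interpI _ _ _ A i (exist _ s' si) w /\ t = map_tuple sval w
    | inr i => fun t : 1.-tuple U => dom A i (thead t)
    end.

Lemma combP_inhabited (L : language) (I U : Type) (A : Pfamily L I U) :
  inhabited I -> inhabited U.
Proof. by case=> i; have [x _] := dom_neq0 A i; exists. Qed.

Definition combP (L : language) (I U : Type) (I0 : inhabited I)
    (A : Pfamily L I U) : structure (langP L I) :=
  Structure (combP_inhabited A I0) (@interpP L I U A).

(* Each member of the family is the restriction to its universe and its
   language of the union of the family. *)
Definition is_Pcombination (L : language) (I U : Type) (A : Pfamily L I U) :
    Prop :=
  forall (i : I) (s : L) (si : s \in lang A i) (w : (arity s).-tuple (dom A i)),
    @interpI _ _ _ A i (exist _ s si) w
    <-> @interpP _ _ _ A (inl s) (map_tuple sval w).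

(* The realizations of the type {~ P_i(x) | i in I} in M. *)
Definition p_infty (L : language) (I : Type) (M : structure (langP L I)) :
    set M :=
  [set x | forall i : I, ~ @interp (langP L I) M (inr i) [tuple x]].

Arguments p_infty {L I} M.

Definition infty_theories (L : language) (I : Type) (T : theory (langP L I)) :
    set (theory (langP L I)) :=
  [set T' | exists (M : structure (langP L I)) (M0 : p_infty M !=set0),
              models M T /\ T' = Th (restr M0)].

Definition is_eSpP (L : language) (I : Type) (T : theory (langP L I))
    (K : Type) : Prop :=
  (infty_theories T #= [set: K])%card.

(* Main.v *)
Require Import Defs.
From mathcomp Require Import all_boot.
From mathcomp Require Import boolp classical_sets functions cardinality.

(** Both kinds of e-spectrum count theories of relativizations of models of T
    to a set cut out by formulas [th i (a, x)] : the E-class of [a], or the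
    set of realizations of p_infty, for which [a] is a dummy parameter.

    The dichotomy is a perfect set theorem. A countable model of T, enumerated
    together with witnesses for its false universal formulas and with reasons
    why points lie outside the relativizing set, is coded by a point of the
    Baire space. Every condition that a code must satisfy looks at finitely many
    of its values, so the codes form a closed set ([coherent_closed]), and the
    theory of the relativization depends continuously on the code. A Skolem hull
    shows that every theory to be counted has a code ([code_of_model]), and a
    quotient of the natural numbers turns a code into a model
    ([model_of_code]). A continuous image of a closed subset of the Baire space
    is countable or contains a copy of the Cantor space ([perfect_image]), which
    settles P-combinations ([eSpP_value]). For E-combinations the e-spectrum of
    a model M of T counts the theories of classes of models of T that are not
    theories of classes of M: when all these theories are countably many, a
    supremum of countable cardinals is taken; otherwise a countable M leaves
    continuum many of them ([eSpE_value]).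

    To realize a value by E-combinations, take one-point structures with unary
    predicates. The classes of the combination are finite approximations of a
    family of limit patterns, indexed by a set of the prescribed cardinality and
    closed in the Cantor space. Each approximation is isolated, hence present in
    every model, while no limit is present in the combination; and adding all
    the limits gives an elementary extension, because a limit can be exchanged
    with a long approximation by an automorphism of any finite reduct
    ([elementary_of_automorphisms]). So the e-spectrum counts the limits.

    For P-combinations limit points come in any number, and the number must be
    made invisible. The structure consists of blocks, the named parts, and of a
    point [None] lying in all parts. Through [None] each point is linked to
    infinitely many points of each colour available in its block; as [None] is
    outside p_infty, the links disappear in the restriction. Hence the
    realizations of p_infty form a set whose points of each occurring colour,
    and of no colour, are infinitely many, and its theory is determined by the
    set of colours that occur ([infty_Th]). The links force this set to be an
    ideal of a chosen ordering of the colours, and every ideal is obtained by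
    adding one block ([Th_extended]). Every positive value is the number of
    ideals of some ordering, and a single part covering everything leaves no
    realization of p_infty, which gives the value 0. *)

Set Implicit Arguments.
Unset Strict Implicit.
Unset Printing Implicit Defensive.

Local Open Scope classical_set_scope.

(** * Cardinals, numberings and tuples *)

Lemma card_le_inj (T U : Type) (A : set T) (B : set U) (f : T -> U) :
  (forall x, A x -> B (f x)) ->
  (forall x y, A x -> A y -> f x = f y -> x = y) -> (A #<= B)%card.
Proof.
move=> fAB fI; apply: card_le_trans (_ : (f @` A #<= B)%card).
  have : {in A &, injective f} by move=> x y /set_mem Ax /set_mem Ay; exact: fI.
  by move/inj_card_eq; rewrite card_eq_sym card_eq_le => /andP[].
by apply: subset_card_le => _ [x Ax <-]; exact: fAB.
Qed.

Lemma card_le_surj (T U : Type) (A : set T) (B : set U) (f : T -> U) :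
  B `<=` f @` A -> (B #<= A)%card.
Proof.
move=> fAB.
have /choice[g gP] : forall u : U, exists t : option T,
    B u -> exists2 t', t = Some t' & A t' /\ f t' = u.
  move=> u; case: (pselect (B u)) => [/fAB[t At <-]|nBu]; last by exists None.
  by exists (Some t) => _; exists t.
apply: card_le_trans (_ : (Some @` A #<= A)%card); last first.
  by rewrite card_ge_some; exact: card_lexx.
apply: (@card_le_inj _ _ _ _ g) => [u /gP[t -> [At _]]|u v /gP[t -> [_ <-]]].
  by exists t.
by move=> /gP[t' -> [_ <-]] [->].
Qed.

Lemma countable_le (T U : Type) (A : set T) (B : set U) :
  (A #<= B)%card -> countable B -> countable A.
Proof. exact: card_le_trans. Qed.

Lemma countable_setU (T : Type) (A B : set T) :
  countable A -> countable B -> countable (A `|` B).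
Proof.
move=> cA cB; rewrite -bigcup2E; apply: bigcup_countable => // i _.
by case: i => [|[|i]] //=; exact: countable0.
Qed.

Lemma countable_inj (T : Type) : countable [set: T] ->
  exists f : T -> nat, injective f.
Proof.
by move=> /countable_injP[f fI]; exists f => x y; apply: fI; rewrite inE.
Qed.

Lemma inj_countable (T : Type) (C : countType) (f : T -> C) :
  injective f -> countable [set: T].
Proof.
move=> fI; apply/countable_injP; exists (pickle \o f) => x y _ _ /=.
by move/(pcan_inj pickleK)/fI.
Qed.

Lemma surjection_from_nat (I : Type) : countable [set: I] -> inhabited I ->
  exists i : nat -> I, forall j, exists k, i k = j.
Proof.
move=> /countable_inj[c cI] [i0].
have /choice[i iP] : forall k, exists i, forall j, c j = k -> i = j.
  move=> k; case: (pselect (exists j, c j = k)) => [[j <-]|no].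
    by exists j => j' /cI.
  by exists i0 => j jk; case: no; exists j.
by exists i => j; exists (c j); exact: iP.
Qed.

Lemma injective_unbounded (g : nat -> nat) r : injective g -> exists p, r <= g p.
Proof.
move=> gI; apply: contrapT => /forallNP no.
have : size (map g (iota 0 r.+1)) <= size (iota 0 r).
  apply: uniq_leq_size; first by rewrite map_inj_uniq // iota_uniq.
  by move=> _ /mapP[p _ ->]; rewrite mem_iota /= ltnNge; apply/negP/no.
by rewrite size_map !size_iota ltnn.
Qed.

Lemma injective_extend (I : Type) (num : I -> nat) (ans : I -> nat) :
  injective num -> exists x : nat -> nat, forall i, x (num i) = ans i.
Proof.
move=> numI; have /choice[x xP] : forall k, exists c, forall i, num i = k -> c = ans i.
  move=> k; case: (pselect (exists i, num i = k)) => [[i <-]|no].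
    by exists (ans i) => j /numI ->.
  by exists 0 => i ik; case: no; exists i.
by exists x => i; exact: xP.
Qed.

Lemma injective_avoids (T : Type) (y : nat -> T) n (u : n.-tuple T) :
  injective y -> exists j, forall i, tnth u i <> y j.
Proof.
move=> yI; apply: contrapT => no.
have /choice[g gP] : forall j, exists i, tnth u i = y j.
  move=> j; apply: contrapT => nj; apply: no; exists j => i ij.
  by apply: nj; exists i.
have gI : injective (fun j => nat_of_ord (g j)).
  by move=> j k /val_inj e; apply: yI; rewrite -!gP e.
by have [p] := injective_unbounded n gI; rewrite leqNgt ltn_ord.
Qed.

Lemma uncountable_cantor : ~ countable [set: nat -> bool].
Proof.
move=> /countable_inj[c cI].
have [x xE] := injective_extend (fun b : nat -> bool => b (c b) : nat) cI.
pose d n := x n == 0.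
by have := xE d; rewrite {2}/d; case: (x (c d)).
Qed.

Lemma card_ordinal n : ([set: 'I_n] #= `I_n)%card.
Proof.
apply/card_eqPle; split.
  apply: (@card_le_inj _ _ _ _ (fun i : 'I_n => nat_of_ord i)) => [i _|i j _ _ /val_inj //].
  exact: ltn_ord.
case: n => [|n]; first by rewrite (_ : `I_0 = set0) ?card_le_emptyl //; apply/seteqP; split.
apply: (@card_le_surj _ _ _ _ (fun i : 'I_n.+1 => nat_of_ord i)) => i /= lt.
by exists (Ordinal lt).
Qed.

Lemma card_le_or_gt (T : Type) (A : set T) n :
  (A #<= `I_n)%card \/ (`I_n.+1 #<= A)%card.
Proof.
case: (pselect (finite_set A)) => [/finite_setP[m Am]|/infiniteP infA]; last first.
  by right; apply: card_le_trans infA; exact: subset_card_le.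
rewrite (card_le_eql Am) (card_le_eqr Am) !card_le_II.
by case: (leqP m n) => ?; [left|right].
Qed.

Lemma countable_value (T : Type) (A : set T) : countable A ->
  exists k, (A #= [set: value_type k])%card.
Proof.
move=> cA; case: (pselect (finite_set A)) => [/finite_setP[n An]|infA].
  exists (Defs.Finite n); rewrite (card_eql An).
  by rewrite card_eq_sym; exact: card_ordinal.
by exists Omega; apply/card_eqPle; split=> //; exact/infiniteP.
Qed.

Lemma initial_segment_inj a b : `I_a = `I_b -> a = b.
Proof.
move=> e; apply/eqP; rewrite eqn_leq; apply/andP; split; rewrite leqNgt; apply/negP => lt.
  by have : `I_a b by []; rewrite e /= ltnn.
by have : `I_b a by []; rewrite -e /= ltnn.
Qed.

Section Swap.
Variables (T : Type) (x y : T).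
Definition swap (z : T) : T :=
  if pselect (z = x) then y else if pselect (z = y) then x else z.

Lemma swapL : swap x = y.
Proof. by rewrite /swap; case: pselect => // /(_ erefl). Qed.

Lemma swapR : swap y = x.
Proof.
rewrite /swap; case: pselect => //= _.
by case: pselect => // /(_ erefl).
Qed.

Lemma swapN z : z <> x -> z <> y -> swap z = z.
Proof.
by rewrite /swap; case: (pselect (z = x)) => //; case: (pselect (z = y)).
Qed.

Lemma swapP (P : T -> T -> Prop) :
  P x y -> P y x -> (forall z, z <> x -> z <> y -> P z z) ->
  forall z, P z (swap z).
Proof.
move=> Pxy Pyx Pz z; case: (pselect (z = x)) => [->|zx]; first by rewrite swapL.
case: (pselect (z = y)) => [->|zy]; first by rewrite swapR.
by rewrite swapN //; exact: Pz.
Qed.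

Lemma swapK : involutive swap.
Proof.
apply: (@swapP (fun z z' => swap z' = z)) => [||z]; last exact: swapN.
  exact: swapR.
exact: swapL.
Qed.

End Swap.

Lemma map_cons_tuple (T U : Type) (h : T -> U) n a (v : n.-tuple T) :
  map_tuple h (cons_tuple a v) = cons_tuple (h a) (map_tuple h v).
Proof. exact: val_inj. Qed.

Lemma map_tnth_map (T U : Type) (h : T -> U) n m (v : n.-tuple T)
    (xs : m.-tuple 'I_n) :
  map_tuple (tnth (map_tuple h v)) xs = map_tuple h (map_tuple (tnth v) xs).
Proof. by apply: eq_from_tnth => i; rewrite !tnth_map. Qed.

Lemma map_tuple1 (T U : Type) (h : T -> U) a : map_tuple h [tuple a] = [tuple h a].
Proof. exact: val_inj. Qed.

Lemma tuple1_eta (T : Type) (t : 1.-tuple T) : t = [tuple thead t].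
Proof. by apply: eq_from_tnth => i; rewrite ord1. Qed.

Lemma tuple2_eta (T : Type) (t : 2.-tuple T) :
  t = [tuple tnth t ord0; tnth t ord_max].
Proof.
apply: eq_from_tnth => -[[|[|//]] lt].
  by rewrite (_ : Ordinal lt = ord0) //; exact: val_inj.
by rewrite (_ : Ordinal lt = ord_max) //; exact: val_inj.
Qed.

(** * A perfect set theorem for continuous images *)

Definition agree (n : nat) (x x' : nat -> nat) : Prop :=
  forall k, k < n -> x k = x' k.

Definition baire_closed (F : set (nat -> nat)) : Prop :=
  forall x, (forall n, exists2 x', F x' & agree n x x') -> F x.

Definition baire_continuous (W : Type) (y : (nat -> nat) -> set W) : Prop :=
  forall w, exists n, forall x x', agree n x x' -> y x w -> y x' w.

Section PerfectSet.
Variables (W : Type) (F : set (nat -> nat)) (y : (nat -> nat) -> set W).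
Hypothesis Fclosed : baire_closed F.
Hypothesis ycont : baire_continuous y.

Let extends (s : seq nat) (x : nat -> nat) : Prop :=
  forall k, k < size s -> x k = nth 0 s k.

Let cone (s : seq nat) : set (nat -> nat) := F `&` extends s.

Let big (s : seq nat) : Prop := ~ countable (y @` cone s).

Lemma extends_mkseq x n : extends (mkseq x n) x.
Proof. by move=> k; rewrite size_mkseq => kn; rewrite nth_mkseq. Qed.

(** Values taken on small cones are countably many, as there are countably many
    cones; removing them leaves an uncountable set of values at points all of
    whose neighbourhoods are big. *)
Lemma big_two_branches s : big s -> exists x0 x1,
  [/\ cone s x0, cone s x1, forall n, big (mkseq x0 n),
      forall n, big (mkseq x1 n) & y x0 <> y x1].
Proof.
move=> bs; apply: contrapT => no; apply: bs.
pose G := [set x | cone s x /\ forall n, big (mkseq x n)].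
pose S := \bigcup_(t in [set t | ~ big t]) y @` cone t.
have cS : countable S.
  by apply: bigcup_countable => // t /contrapT.
have cG : countable (y @` G).
  apply: finite_set_countable.
  case: (pselect (G !=set0)) => [[x0 [c0 b0]]|G0]; last first.
    suff -> : G = set0 by rewrite image_set0; exact: finite_set0.
    by rewrite -subset0 => x Gx; apply: G0; exists x.
  apply: sub_finite_set (finite_set1 (y x0)) => _ [x1 [c1 b1] <-] /=.
  by apply: contrapT => ne; apply: no; exists x1, x0.
apply: countable_le (countable_setU cG cS).
apply: subset_card_le => _ [x cx <-].
case: (pselect (forall n, big (mkseq x n))) => [b|/existsNP[n sn]].
  by left; exists x.
right; exists (mkseq x n) => //; exists x => //.
by split; [case: cx | exact: extends_mkseq].
Qed.

Lemma big_split s : big s -> exists t : bool -> seq nat,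
  [/\ forall b, big (t b), forall b, size s < size (t b),
      forall b k, k < size s -> nth 0 (t b) k = nth 0 s k
    & exists w, forall x0 x1, extends (t false) x0 -> extends (t true) x1 ->
        ~ (y x0 w <-> y x1 w)].
Proof.
move=> /big_two_branches[x0 [x1 [[_ c0] [_ c1] b0 b1 ne]]].
have [w nw] : exists w, ~ (y x0 w <-> y x1 w).
  by apply/existsNP => e; apply: ne; apply/predeqP.
have [n yn] := ycont w.
pose m := maxn n (size s).+1.
have nm : n <= m by rewrite leq_maxl.
have sm : size s < m by rewrite leq_maxr.
exists (fun b => mkseq (if b then x1 else x0) m); split.
- by case.
- by move=> b; rewrite size_mkseq.
- move=> b k ks; rewrite nth_mkseq ?(ltn_trans ks) //.
  by case: b; [apply: c1 | apply: c0].
- exists w => u0 u1 e0 e1 eu; apply: nw.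
  have a0 : agree n u0 x0.
    move=> k kn; have km := leq_trans kn nm.
    by rewrite e0 ?size_mkseq ?nth_mkseq.
  have a1 : agree n u1 x1.
    move=> k kn; have km := leq_trans kn nm.
    by rewrite e1 ?size_mkseq ?nth_mkseq.
  have sym u v : agree n u v -> agree n v u by move=> a k /a.
  split=> [/(yn _ _ (sym _ _ a0))/eu|/(yn _ _ (sym _ _ a1))/eu]; exact: yn.
Qed.

(** Splitting big cones repeatedly gives a Cantor scheme; along a branch the
    cones are nonempty, so closedness of [F] puts the limit in [F], and at the
    node where two branches part their values are separated. *)
Theorem perfect_image : ~ countable (y @` F) ->
  exists g : (nat -> bool) -> nat -> nat,
    (forall b, F (g b)) /\ (forall b c, y (g b) = y (g c) -> b = c).
Proof.
move=> unc.
have big0 : big [::].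
  move=> c; apply: unc; apply: countable_le c; apply: subset_card_le.
  by move=> _ [x Fx <-]; exists x => //; split.
have /choice[sp spP] : forall s, exists t : bool -> seq nat, big s ->
  [/\ forall b, big (t b), forall b, size s < size (t b),
      forall b k, k < size s -> nth 0 (t b) k = nth 0 s k
    & exists w, forall x0 x1, extends (t false) x0 -> extends (t true) x1 ->
        ~ (y x0 w <-> y x1 w)].
  move=> s; case: (pselect (big s)) => [/big_split[t tP]|nb]; first by exists t.
  by exists (fun=> [::]).
pose node b := fix node n := if n is n'.+1 then sp (node n') (b n') else [::].
have nodeS b n : node b n.+1 = sp (node b n) (b n) by [].
have bigN b n : big (node b n).
  by elim: n => [|n /spP[+ _ _ _]] //; rewrite nodeS; apply.
have sizeN b n : n <= size (node b n).
  elim: n => [|n IH] //; have [_ lt _ _] := spP _ (bigN b n).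
  by rewrite nodeS (leq_ltn_trans IH).
have mono b n d : size (node b n) <= size (node b (n + d)) /\
    forall k, k < size (node b n) -> nth 0 (node b (n + d)) k = nth 0 (node b n) k.
  elim: d => [|d [IH1 IH2]]; first by rewrite addn0.
  rewrite addnS nodeS; have [_ lt pr _] := spP _ (bigN b (n + d)).
  split=> [|k kn]; first exact: leq_trans IH1 (ltnW (lt _)).
  by rewrite pr ?IH2 // (leq_trans kn).
pose g b k := nth 0 (node b k.+1) k.
have gP b n : extends (node b n) (g b).
  move=> k kn; rewrite /g; case: (leqP n k.+1) => [le|/ltnW le].
    have [_ pr] := mono b n (k.+1 - n); rewrite subnKC // in pr.
    exact: pr.
  have [_ pr] := mono b k.+1 (n - k.+1); rewrite subnKC // in pr.
  by rewrite pr.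
exists g; split=> [b|b c eq_y].
  apply: Fclosed => n; apply: contrapT => no; apply: (bigN b n).
  suff -> : cone (node b n) = set0 by rewrite image_set0; exact: countable0.
  rewrite -subset0 => x [Fx ex]; apply: no; exists x => // k kn.
  by rewrite (gP b n) ?ex // (leq_trans kn).
apply: contrapT => ne.
have [n0 /eqP nn0] : exists n, b n <> c n.
  by apply/existsNP => e; apply: ne; apply/funext.
have ex : exists n, b n != c n by exists n0.
case: (ex_minnP ex) => n nbc min.
have eqn m : m <= n -> node b m = node c m.
  elim: m => [|m IH] // mn; rewrite !nodeS IH ?(ltnW mn) //.
  by congr (sp _ _); apply/eqP/negPn/negP => /min; rewrite leqNgt mn.
have [_ _ _ [w wP]] := spP _ (bigN b n).
have eb := gP b n.+1; have ec := gP c n.+1.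
rewrite !nodeS -?(eqn n) // in eb ec.
have [bn cn] : b n = ~~ c n /\ true by case: (b n) (c n) nbc => [] [].
move: eb ec; rewrite bn; case: (c n) => /= eb ec.
  by apply: (wP _ _ eb ec); rewrite eq_y.
by apply: (wP _ _ ec eb); rewrite eq_y.
Qed.

End PerfectSet.

(** * Formulas and satisfaction *)

Section FormulaCode.
Variables (L : language) (code : L -> nat).
Hypothesis codeI : injective code.

Fixpoint formula_tree n (f : formula L n) : GenTree.tree nat :=
  match f with
  | Bot => GenTree.Leaf 0
  | Eq x y => GenTree.Node 0 [:: GenTree.Leaf (x : nat); GenTree.Leaf (y : nat)]
  | Rel s xs => GenTree.Node 1
      (GenTree.Leaf (code s) :: [seq GenTree.Leaf (x : nat) | x : 'I_n <- xs])
  | Imp f g => GenTree.Node 2 [:: formula_tree f; formula_tree g]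
  | All f => GenTree.Node 3 [:: formula_tree f]
  end.

Lemma formula_treeI n : injective (@formula_tree n).
Proof.
move=> f; elim: f => {n} [n|n x y|n s xs|n f IHf g IHg|n f IHf]
  [|x' y'|s' xs'|f' g'|f'] //=.
- by case=> /val_inj -> /val_inj ->.
- case=> /codeI es; move: xs'; rewrite -es => xs' e; congr Rel; apply: val_inj.
  by apply: inj_map e => i j [] /val_inj.
- by case=> /IHf -> /IHg ->.
- by case=> /IHf ->.
Qed.

End FormulaCode.

Lemma countable_formula (L : language) : countable [set: L] ->
  countable [set: {n & formula L n}].
Proof.
move=> /countable_inj[code codeI].
apply: (@inj_countable _ _ (fun p => (projT1 p, formula_tree code (projT2 p)))).
move=> [n f] [m g] /= [e]; case: _ / e g => g /(formula_treeI codeI) -> //.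
Qed.

Lemma countable_theory (L : language) (T : theory L) :
  countable [set: L] -> countable T.
Proof.
move=> /countable_formula cf; apply: countable_le cf.
apply: (@card_le_inj _ _ _ _ (fun f : sentence L => existT (formula L) 0 f)) => //.
by move=> f g _ _; exact: existT_inj2.
Qed.

Definition Neg L n (f : formula L n) : formula L n := Imp f (Bot L n).

Definition And L n (f g : formula L n) : formula L n := Neg (Imp f (Neg g)).

Lemma sat_And L (M : structure L) n (f g : formula L n) (v : n.-tuple M) :
  sat (And f g) v <-> sat f v /\ sat g v.
Proof.
split=> [|[sf sg]] /=; last by apply.
by move=> H; split; apply: contrapT => nf; apply: H => // ?; contradiction.
Qed.

Definition Ex L n (f : formula L n.+1) : formula L n := Neg (All (Neg f)).

Lemma sat_Ex L (M : structure L) n (f : formula L n.+1) (v : n.-tuple M) :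
  sat (Ex f) v <-> exists a, sat f (cons_tuple a v).
Proof.
split=> [H|[a fa] /= /(_ a fa) //].
by apply: contrapT => no; apply: H => a fa; apply: no; exists a.
Qed.

(** A complete theory decides for each symbol the sentence saying that all
    constant tuples satisfy it; so the symbols inject into the theory. *)
Lemma countable_Th (L : language) (M : structure L) :
  countable (Th M) -> countable [set: L].
Proof.
move=> cT; apply: countable_le cT.
pose d (s : L) : sentence L := All (Rel (nseq_tuple (arity s) ord0)).
pose f (s : L) := if pselect (Th M (d s)) then d s else Neg (d s).
pose head (g : sentence L) : option L :=
  match g with
  | All (Rel s _) | Imp (All (Rel s _)) _ => Some s
  | _ => None
  end.
have headf s : head (f s) = Some s by rewrite /f; case: (pselect (Th M (d s))).
apply: (@card_le_inj _ _ _ _ f) => [s _|s t _ _ /(congr1 head)].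
  by rewrite /f; case: (pselect (Th M (d s))).
by rewrite !headf => -[].
Qed.

Fixpoint over (L : language) (S : set L) n (f : formula L n) : Prop :=
  match f with
  | Bot | Eq _ _ => True
  | Rel s _ => S s
  | Imp f g => over S f /\ over S g
  | All f => over S f
  end.

Lemma over_sub (L : language) (S S' : set L) n (f : formula L n) :
  S `<=` S' -> over S f -> over S' f.
Proof.
move=> SS; elim: f => {n} //= [n s xs|n f IHf g IHg]; first exact: SS.
by case=> /IHf ? /IHg.
Qed.

Lemma over_bounded (L : language) (rk : L -> nat) n (f : formula L n) :
  exists r, over [set s | rk s < r] f.
Proof.
elim: f => {n} /= [n|n x y|n s xs|n f [r fr] g [q gq]|n f [r fr]].
- by exists 0.
- by exists 0.
- by exists (rk s).+1.
- exists (maxn r q); split; [apply: over_sub fr | apply: over_sub gq] => s /=.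
    by move=> /leq_trans; apply; exact: leq_maxl.
  by move=> /leq_trans; apply; exact: leq_maxr.
- by exists r.
Qed.

Definition preserves (L : language) (M N : structure L) (S : set L)
    (h : M -> N) : Prop :=
  forall s (t : (arity s).-tuple M), S s ->
    (interp (map_tuple h t) <-> interp t).

Lemma sat_iso (L : language) (M N : structure L) (S : set L) (h : M -> N)
    n (f : formula L n) (v : n.-tuple M) :
  injective h -> (forall y, exists x, h x = y) -> preserves S h -> over S f ->
  sat f (map_tuple h v) <-> sat f v.
Proof.
move=> hI hS hP; elim: f v => {n} /= [n|n x y|n s xs|n f IHf g IHg|n f IHf] v.
- by [].
- by move=> _; rewrite !tnth_map; split=> [/hI|->].
- by move=> Ss; rewrite map_tnth_map; exact: hP.
- by case=> of_ og; rewrite (IHf v of_) (IHg v og).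
- move=> of_; split=> [H a|H b].
    by apply/(IHf _ of_); rewrite map_cons_tuple; exact: H.
  by have [a <-] := hS b; rewrite -map_cons_tuple; apply/(IHf _ of_).
Qed.

Lemma over_setT (L : language) n (f : formula L n) : over setT f.
Proof. by elim: f => {n} /=. Qed.

Lemma iso_Th (L : language) (M N : structure L) (h : M -> N) :
  injective h -> (forall y, exists x, h x = y) -> preserves setT h ->
  Th M = Th N.
Proof.
move=> hI hS hP; apply/predeqP => f; rewrite /Th /=.
rewrite -(sat_iso [tuple] hI hS hP (over_setT f)).
by rewrite (_ : map_tuple h _ = [tuple]) //; exact: val_inj.
Qed.

(** The Tarski-Vaught test: a witness [b] outside [M] for a formula with
    parameters in [M] is moved into [M] by an automorphism of the finite reduct
    to the symbols of the formula. *)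
Lemma elementary_of_automorphisms (L : language) (rk : L -> nat)
    (M N : structure L) (h : M -> N) :
  injective h -> preserves setT h ->
  (forall r n (v : n.-tuple M) (b : N), exists (g : N -> N) (a : M),
     [/\ injective g, forall y, exists x, g x = y,
         preserves [set s | rk s < r] g,
         forall i, g (h (tnth v i)) = h (tnth v i) & g b = h a]) ->
  Th M = Th N.
Proof.
move=> hI hP aut.
suff H n (f : formula L n) v : sat f v <-> sat f (map_tuple h v).
  apply/predeqP => f; rewrite /Th /= H.
  by rewrite (_ : map_tuple h _ = [tuple]) //; exact: val_inj.
elim: f v => {n} /= [n|n x y|n s xs|n f IHf g IHg|n f IHf] v.
- by [].
- by rewrite !tnth_map; split=> [->|/hI].
- by rewrite map_tnth_map hP.
- by rewrite IHf IHg.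
split=> [H b|H a]; last by rewrite IHf map_cons_tuple; exact: H.
have [r fr] := over_bounded rk f.
have [g [a [gI gS gP gv gb]]] := aut r n v b.
have := H a; rewrite IHf map_cons_tuple -gb.
have fixv : map_tuple h v = map_tuple g (map_tuple h v).
  by apply: eq_from_tnth => i; rewrite !tnth_map gv.
by rewrite {1}fixv -map_cons_tuple (sat_iso _ gI gS gP fr).
Qed.

(** Relativization to [Q] keeps the tuples in [M] and so avoids subtypes; it is
    satisfaction in the restriction when they lie in [Q], see [sat_restr]. *)
Fixpoint rsat (L : language) (M : structure L) (Q : set M) n
    (f : formula L n) : n.-tuple M -> Prop :=
  match f with
  | Bot => fun _ => False
  | Eq x y => fun v => tnth v x = tnth v y
  | Rel s xs => fun v => interp (map_tuple (tnth v) xs)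
  | Imp f g => fun v => rsat Q f v -> rsat Q g v
  | All f => fun v => forall a : M, Q a -> rsat Q f (cons_tuple a v)
  end.

Lemma rsat_setT (L : language) (M : structure L) n (f : formula L n)
    (v : n.-tuple M) : rsat setT f v <-> sat f v.
Proof.
elim: f v => {n} //= [n f IHf g IHg|n f IHf] v; first by rewrite IHf IHg.
by split=> H a => [|_]; apply/IHf; exact: H.
Qed.

Lemma sat_restr (L : language) (M : structure L) (Q : set M)
    (Q0 : Q !=set0) n (f : formula L n) (v : n.-tuple (restr Q0)) :
  sat f v <-> rsat Q f (map_tuple sval v).
Proof.
elim: f v => {n} /= [n|n x y|n s xs|n f IHf g IHg|n f IHf] v.
- by [].
- by rewrite !tnth_map; split=> [->|/val_inj].
- by rewrite map_tnth_map.
- by rewrite IHf IHg.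
split=> [H a Qa|H a].
  have := H (exist _ a (mem_set Qa)); rewrite IHf map_cons_tuple; exact.
by rewrite IHf map_cons_tuple; apply: H; exact: set_mem (svalP a).
Qed.

Lemma Th_restr (L : language) (M : structure L) (Q : set M)
    (Q0 : Q !=set0) : Th (restr Q0) = [set f | rsat Q f [tuple]].
Proof.
apply/predeqP => f; rewrite /Th /= sat_restr.
by rewrite (_ : map_tuple _ _ = [tuple]) //; exact: val_inj.
Qed.

Fixpoint universal_closure (L : language) n : formula L n -> sentence L :=
  match n with
  | 0 => id
  | n'.+1 => fun f => universal_closure (All f)
  end.

Lemma sat_closure (L : language) (M : structure L) n (f : formula L n) :
  Th M (universal_closure f) <-> forall v : n.-tuple M, sat f v.
Proof.
elim: n f => [|n IH] f /=.
  by split=> [H v|]; [rewrite (tuple0 v) | apply].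
rewrite IH /=; split=> [H v|H v a]; last exact: H.
by rewrite (tuple_eta v); exact: (H (behead_tuple v) (thead v)).
Qed.

Lemma transfer (L : language) (M N : structure L) n (f : formula L n) :
  models N (Th M) -> (forall v : n.-tuple M, sat f v) ->
  forall v : n.-tuple N, sat f v.
Proof. by move=> MN H; apply/sat_closure/MN/sat_closure. Qed.

Lemma models_Th (L : language) (M N : structure L) :
  models N (Th M) -> Th N = Th M.
Proof.
move=> MN; apply/predeqP => f; split=> [Nf|]; last exact: MN.
apply: contrapT => nMf; have /MN : Th M (Neg f) by [].
by apply.
Qed.

(** * Codes of countable models *)

(** The operation [op i] is applied to [l] at all the stages that code
    [(i, l, p)] for some [p], hence at a stage later than the members of [l]. *)
Lemma enumerated_hull (M : Type) (op : nat -> seq M -> M) (a q : M) :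
  exists e : nat -> M, [/\ e 0 = a, e 1 = q &
    forall i l, exists k, e k = op i (map e l)].
Proof.
pose F k (l : seq M) := match k with
  | 0 => a
  | 1 => q
  | k'.+2 => if @unpickle (nat * seq nat * nat)%type k' is Some (i, l', _)
             then op i (map (nth a l) l') else a
  end.
pose es := fix es k := if k is k'.+1 then rcons (es k') (F k' (es k')) else [::].
pose e k := F k (es k).
have esE k : es k = mkseq e k.
  by elim: k => [|k IH] //=; rewrite mkseqS -[in RHS]IH.
exists e; split=> // i l.
pose g (p : nat) := pickle (i, l, p).
have gI : injective g by move=> p p' /(pcan_inj pickleK) [].
have [p lp] := injective_unbounded (\max_(j <- l) j) gI.
exists (g p).+2.
have -> : e (g p).+2 = op i (map (nth a (es (g p).+2)) l).
  by rewrite {1}/e {1}/F /g pickleK.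
congr (op i _); apply/eq_in_map => j jl; rewrite esE nth_mkseq // ltnS.
apply: leq_trans (leqnSn _); apply: leq_trans lp.
exact: (leq_bigmax_seq j jl).
Qed.

(** Intersections of local properties are closed; so a definition all of whose
    clauses are local describes a closed set. *)
Definition local (P : (nat -> nat) -> Prop) : Prop :=
  exists n, forall x x', agree n x x' -> P x <-> P x'.

Lemma local_val k c : local (fun x => x k = c).
Proof. by exists k.+1 => x x' /(_ k (ltnSn k)) ->. Qed.

Lemma local_cst (P : Prop) : local (fun=> P).
Proof. by exists 0. Qed.

Lemma agree_le m n x x' : m <= n -> agree n x x' -> agree m x x'.
Proof. by move=> mn a k km; apply: a; exact: leq_trans mn. Qed.

Lemma local_imp P Q : local P -> local Q -> local (fun x => P x -> Q x).
Proof.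
move=> [m mP] [n nQ]; exists (maxn m n) => x x' a.
have aP := mP _ _ (agree_le (leq_maxl m n) a).
by have aQ := nQ _ _ (agree_le (leq_maxr m n) a); rewrite aP aQ.
Qed.

Lemma local_and P Q : local P -> local Q -> local (fun x => P x /\ Q x).
Proof.
move=> [m mP] [n nQ]; exists (maxn m n) => x x' a.
have aP := mP _ _ (agree_le (leq_maxl m n) a).
by have aQ := nQ _ _ (agree_le (leq_maxr m n) a); rewrite aP aQ.
Qed.

Lemma local_not P : local P -> local (fun x => ~ P x).
Proof. by move=> lP; apply: local_imp lP (local_cst False). Qed.

Lemma local_iff P Q : local P -> local Q -> local (fun x => P x <-> Q x).
Proof. by move=> lP lQ; apply: local_and; exact: local_imp. Qed.

Lemma local_forall (I : finType) (P : I -> (nat -> nat) -> Prop) :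
  (forall i, local (P i)) -> local (fun x => forall i, P i x).
Proof.
move=> /choice[m mP]; exists (\max_i m i) => x x' a.
have aP i : P i x <-> P i x'.
  by apply: mP; apply: agree_le a; exact: leq_bigmax.
by split=> H i; apply/aP.
Qed.

Lemma local_closed (C : set (nat -> nat)) P x : local P ->
  (forall n, exists2 x', C x' & agree n x x') -> (forall x', C x' -> P x') -> P x.
Proof. by move=> [n nP] /(_ n)[x' /[swap] /nP -> Cx']; apply. Qed.

Section CodedModels.
Variables (L : language) (T : theory L) (th : nat -> formula L 2).

(** The relativizing sets. With a single formula [E(a, x)] the zone is the class
    of [a]; with the formulas [~ P_i(x)] it is the set of realizations of
    p_infty, whatever the parameter [a]. *)
Definition zone (M : structure L) (a : M) : set M :=
  [set m | forall i, sat (th i) [tuple a; m]].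

(** A code has a value for each formula with parameters in an enumeration of
    the model, evaluated in the model (for the boolean [false]) and relativized
    to the zone (for [true]), and a value for each point. *)
Definition index : Type :=
  ((bool * {n & (formula L n * n.-tuple nat)%type}) + nat)%type.

Lemma countable_index : countable [set: L] -> countable [set: index].
Proof.
move=> /countable_formula/countable_inj[c cI].
pose h (i : index) := match i with
  | inl (b, existT n (f, v)) => inl (b, c (existT _ n f), val v)
  | inr m => inr m
  end : (bool * nat * seq nat) + nat.
apply: (@inj_countable _ _ h) => -[[b [n [f v]]]|m] [[b' [n' [f' v']]]|m'] //=.
  case=> -> /cI e ev; have en : n = n' := congr1 (fun p => projT1 p) e.
  move: f' v' e ev; rewrite -en => f' v' e /val_inj ->.
  by rewrite (@existT_inj2 nat (formula L) _ _ _ e).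
by case=> ->.
Qed.

Variable num : index -> nat.

(** The value 0 means true; a value [k.+1] for a universal formula means that
    the point number [k] is a counterexample. *)
Definition truth (x : nat -> nat) (b : bool) n (f : formula L n)
    (v : n.-tuple nat) : nat := x (num (inl (b, existT _ n (f, v)))).

(** The value 0 means that the point lies in the zone; the value [i.+1] means
    that the formula [th i] excludes it. *)
Definition zone_code (x : nat -> nat) (m : nat) : nat := x (num (inr m)).

Definition guard (x : nat -> nat) (b : bool) (m : nat) : Prop :=
  b -> zone_code x m = 0.

Definition same (x : nat -> nat) (k l : nat) : Prop :=
  truth x false (Eq L (ord0 : 'I_2) ord_max) [tuple k; l] = 0.

Definition holds (x : nat -> nat) (s : L) (v : (arity s).-tuple nat) : Prop :=
  truth x false (Rel (ord_tuple (arity s))) v = 0.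

(** The point number 0 is the parameter of the zone, and the point number 1
    testifies that the zone is nonempty. *)
Record coherent (x : nat -> nat) : Prop := {
  coh_theory : forall f, T f -> truth x false f [tuple] = 0;
  coh_zone1 : zone_code x 1 = 0;
  coh_bot : forall b n (v : n.-tuple nat), ~ truth x b (Bot L n) v = 0;
  coh_imp : forall b n (f g : formula L n) v, truth x b (Imp f g) v = 0 <->
    (truth x b f v = 0 -> truth x b g v = 0);
  coh_all : forall b n (f : formula L n.+1) v k, truth x b (All f) v = 0 ->
    guard x b k -> truth x b f (cons_tuple k v) = 0;
  coh_witness : forall b n (f : formula L n.+1) v k,
    truth x b (All f) v = k.+1 ->
    guard x b k /\ ~ truth x b f (cons_tuple k v) = 0;
  coh_eq : forall b n i j (v : n.-tuple nat),
    truth x b (Eq L i j) v = 0 <-> same x (tnth v i) (tnth v j);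
  coh_rel : forall b n s xs (v : n.-tuple nat),
    truth x b (@Rel L n s xs) v = 0 <-> holds x (map_tuple (tnth v) xs);
  coh_refl : forall k, same x k k;
  coh_trans : forall k l m, same x k l -> same x k m -> same x l m;
  coh_congr : forall s (v w : (arity s).-tuple nat),
    (forall i, same x (tnth v i) (tnth w i)) -> holds x v -> holds x w;
  coh_zoneE : forall m i, zone_code x m = 0 ->
    truth x false (th i) [tuple 0; m] = 0;
  coh_zoneN : forall m i, zone_code x m = i.+1 ->
    ~ truth x false (th i) [tuple 0; m] = 0 }.

Lemma coherent_closed : baire_closed coherent.
Proof.
move=> x lim.
(* Each clause, with its hypotheses on [x] put back, is a property of [x], and
   its syntax shows that it is local. *)
split; intros;
  repeat match goal with H : context [x] |- _ =>
    lazymatch type of H with forall n, exists2 _, _ & _ => fail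
    | _ => revert H end end;
  pattern x; apply: (local_closed _ lim);
  try (by move=> x' c'; intros; case: c' => *; eauto).
all: rewrite /holds /same /guard /truth /zone_code.
all: by repeat first [exact: local_val | exact: local_cst | apply: local_iff
  | apply: local_and | apply: local_not
  | apply: local_forall | apply: local_imp | intro].
Qed.

Section ModelOfCode.
Variables (x : nat -> nat) (cx : coherent x).

(* A finite model is enumerated with repetitions, and its points are classes of
   numbers that the code declares equal. *)
Let point : Type := {A : set nat | exists k, A = same x k}.

Let pt (k : nat) : point := exist _ (same x k) (ex_intro _ k erefl).

Lemma same_sym k l : same x k l -> same x l k.
Proof. by move=> kl; apply: coh_trans kl (coh_refl cx k). Qed.

Lemma pt_eq k l : pt k = pt l <-> same x k l.
Proof.
split=> [/(congr1 sval)/= ->|kl]; first exact: coh_refl.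
apply: eq_exist; apply/predeqP => m; split=> [km|lm].
  exact: coh_trans kl km.
exact: (coh_trans cx (same_sym kl)).
Qed.

Lemma pt_surj (p : point) : exists k, pt k = p.
Proof. by case: p => A Ak; case: (Ak) => k e; exists k; apply: eq_exist. Qed.

Let quotient : structure L :=
  @Structure L point (inhabits (pt 0))
    (fun s t => exists2 v, t = map_tuple pt v & holds x v).

Lemma quotient_holds s (v : (arity s).-tuple nat) :
  interp (map_tuple pt v : _.-tuple quotient) <-> holds x v.
Proof.
split=> [[w e]|h]; last by exists v.
apply: (coh_congr cx) => i; apply/pt_eq.
by have := congr1 (fun t => tnth t i) e; rewrite !tnth_map.
Qed.

(** This covers satisfaction in the model, for [Q] the full set, and its
    relativization to the zone. *)
Lemma quotient_rsat b (Q : set quotient) n (f : formula L n) v :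
  (forall k, Q (pt k) <-> guard x b k) ->
  rsat Q f (map_tuple pt v) <-> truth x b f v = 0.
Proof.
move=> QE; elim: f v => {n} /= [n|n i j|n s xs|n f IHf g IHg|n f IHf] v.
- by split=> // /(coh_bot cx).
- by rewrite !tnth_map (coh_eq cx) pt_eq.
- by rewrite map_tnth_map (coh_rel cx); exact: quotient_holds.
- by rewrite (coh_imp cx) IHf IHg.
split=> [H|H a].
  case E : (truth x b (All f) v) => [|k] //.
  have [/QE Qk nf] := coh_witness cx E; case: nf.
  by apply/IHf; rewrite map_cons_tuple; exact: H.
have [k <-] := pt_surj a; rewrite -map_cons_tuple QE IHf => gk.
exact: coh_all gk.
Qed.


Lemma model_of_code : exists (M : structure L) (e : nat -> M),
  [/\ forall m, exists k, e k = m, models M T, zone (e 0) (e 1) &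
    forall f : sentence L,
      rsat (zone (e 0)) f [tuple] <-> truth x true f [tuple] = 0].
Proof.
have satE n (f : formula L n) v : sat (M := quotient) f (map_tuple pt v) <->
    truth x false f v = 0.
  by rewrite -rsat_setT; apply: quotient_rsat.
have zoneE k : @zone quotient (pt 0) (pt k) <-> zone_code x k = 0.
  have zE i : sat (M := quotient) (th i) [tuple pt 0; pt k] <->
      truth x false (th i) [tuple 0; k] = 0.
    by rewrite -satE (_ : map_tuple _ _ = [tuple pt 0; pt k]) //; exact: val_inj.
  split=> [H|zk i]; last by apply/zE; exact: coh_zoneE.
  by case E : (zone_code x k) => [|i] //; case: (coh_zoneN cx E); exact/zE.
have nilE : [tuple] = map_tuple pt [tuple] by exact: val_inj.
exists quotient, pt; split.
- exact: pt_surj.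
- by move=> f Tf; rewrite /Th /= nilE; apply/satE; exact: (coh_theory cx).
- by apply/zoneE; exact: (coh_zone1 cx).
move=> f; rewrite nilE; apply: quotient_rsat => k.
by rewrite zoneE; split=> [|H]; [move=> zk _ | exact: H].
Qed.

End ModelOfCode.

Hypothesis numI : injective num.

(** Downward Loewenheim-Skolem: the code describes an enumeration of a set
    containing [a] and [q] and closed under Skolem functions, for satisfaction
    and for relativized satisfaction. *)
Lemma code_of_model (M : structure L) (a q : M) : models M T -> zone a q ->
  exists2 x, coherent x &
    forall f : sentence L,
      rsat (zone a) f [tuple] <-> truth x true f [tuple] = 0.
Proof.
move=> MT zq; pose Q b : set M := if b then zone a else setT.
(* The Skolem function for [All f] is numbered by that formula with dummy
   parameters. *)
have /choice[op opP] : forall p : nat * seq M, exists m : M,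
    forall b n (f : formula L n.+1) (w : n.-tuple M),
    num (inl (b, existT _ n (All f, nseq_tuple n 0))) = p.1 -> w = p.2 :> seq M ->
    (exists m, Q b m /\ ~ rsat (Q b) f (cons_tuple m w)) ->
    Q b m /\ ~ rsat (Q b) f (cons_tuple m w).
  move=> [i l] /=.
  case: (pselect (exists b n (f : formula L n.+1) (w : n.-tuple M),
      [/\ num (inl (b, existT _ n (All f, nseq_tuple n 0))) = i, w = l :> seq M &
       exists m, Q b m /\ ~ rsat (Q b) f (cons_tuple m w)])); last first.
    by move=> no; exists a => b n f w e1 e2 H; case: no; exists b, n, f, w.
  move=> [b [n [f [w [<- <- [m mP]]]]]]; exists m => b' n' f' w' /numI[-> en].
  move: f' w'; rewrite en => f' w' ef _ /val_inj -> _.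
  by rewrite (@existT_inj2 nat (fun n => formula L n.+1) _ _ _ ef).
have [e [e0 e1 hull]] := enumerated_hull (fun i l => op (i, l)) a q.
have wit b n (f : formula L n.+1) (v : n.-tuple nat) :
    (exists m, Q b m /\ ~ rsat (Q b) f (cons_tuple m (map_tuple e v))) ->
    exists k, Q b (e k) /\ ~ rsat (Q b) f (cons_tuple (e k) (map_tuple e v)).
  move=> ex; have [k ek] := hull (num (inl (b, existT _ n (All f, nseq_tuple n 0)))) v.
  by exists k; rewrite ek; apply: opP.
pose answer (i : index) c := match i with
  | inl (b, existT n (f, v)) => (c = 0 <-> rsat (Q b) f (map_tuple e v)) /\
      (forall g k, f = All g -> c = k.+1 ->
        Q b (e k) /\ ~ rsat (Q b) g (cons_tuple (e k) (map_tuple e v)))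
  | inr m => (c = 0 <-> zone a (e m)) /\
      (forall i, c = i.+1 -> ~ sat (th i) [tuple a; e m])
  end.
have /choice[ans ansP] : forall i, exists c, answer i c.
  move=> [[b [n [f v]]]|m] /=.
    case: (pselect (rsat (Q b) f (map_tuple e v))) => [H|nH]; first by exists 0.
    case: (pselect (exists g, f = All g)) => [[g eg]|no].
      have [k kP] : exists k,
          Q b (e k) /\ ~ rsat (Q b) g (cons_tuple (e k) (map_tuple e v)).
        apply: wit; apply: contrapT => no; apply: nH; rewrite eg /= => m Qm.
        by apply: contrapT => nm; apply: no; exists m.
      by exists k.+1; split=> // g' k'; rewrite eg => -[<-] [<-].
    by exists 1; split=> // g k eg; case: no; exists g.
  case: (pselect (zone a (e m))) => [H|/existsNP[i ni]]; first by exists 0.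
  by exists i.+1; split=> [|j [<-]] //; split=> // /(_ i).
have [x xE] := injective_extend ans numI.
have tE b n (f : formula L n) v : truth x b f v = 0 <-> rsat (Q b) f (map_tuple e v).
  by rewrite /truth xE; have [] := ansP (inl (b, existT _ n (f, v))).
have zE m : zone_code x m = 0 <-> zone a (e m).
  by rewrite /zone_code xE; have [] := ansP (inr m).
have gE b m : guard x b m <-> Q b (e m).
  by rewrite /guard zE; case: b => /=; split=> // H; exact: H.
have sE k l : same x k l <-> e k = e l by rewrite /same tE.
have hE s v : holds x v <-> interp (map_tuple e v : (arity s).-tuple M).
  rewrite /holds tE /= (_ : map_tuple _ _ = map_tuple e v) //.
  by apply: eq_from_tnth => i; rewrite !tnth_map tnth_ord_tuple.
have nilE : map_tuple e [tuple] = [tuple] by exact: val_inj.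
have pairE m : map_tuple e [tuple 0; m] = [tuple a; e m].
  by apply: val_inj; rewrite /= e0.
exists x; last by move=> f; rewrite tE nilE.
split.
- by move=> f Tf; rewrite tE nilE rsat_setT; exact: MT.
- by rewrite zE e1.
- by move=> b n v; rewrite tE.
- by move=> b n f g v; rewrite !tE.
- move=> b n f v k; rewrite !tE gE map_cons_tuple => H; exact: H.
- move=> b n f v k; rewrite tE gE map_cons_tuple /truth xE => E.
  by have [_] := ansP (inl (b, existT _ n (All f, v))); apply.
- by move=> b n i j v; rewrite tE sE /= !tnth_map.
- by move=> b n s xs v; rewrite tE hE /= map_tnth_map.
- by move=> k; rewrite sE.
- by move=> k l m; rewrite !sE => -> ->.
- move=> s v w vw; rewrite !hE (_ : map_tuple e v = map_tuple e w) //.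
  by apply: eq_from_tnth => i; rewrite !tnth_map; apply/sE.
- by move=> m i; rewrite zE tE pairE rsat_setT; exact.
move=> m i; rewrite tE pairE rsat_setT /zone_code xE.
by have [_] := ansP (inr m); apply.
Qed.

End CodedModels.

Definition zone_theories (L : language) (T : theory L) (th : nat -> formula L 2) :
    set (theory L) :=
  [set Y | exists (M : structure L) (a : M),
     [/\ models M T, zone th a !=set0 & Y = [set f | rsat (zone th a) f [tuple]]]].

(** The map [lift] reads a theory in a smaller language, which is needed to
    forget the symbol E. *)
Theorem zone_theories_perfect (L : language) (T : theory L)
    (th : nat -> formula L 2) (W : Type) (lift : W -> sentence L) :
  countable [set: L] ->
  ~ countable ((fun Y : theory L => lift @^-1` Y) @` zone_theories T th) ->
  exists2 g : (nat -> bool) -> set W, injective g &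
    forall b, ((fun Y : theory L => lift @^-1` Y) @` zone_theories T th) (g b).
Proof.
move=> /countable_index/countable_inj[num numI].
pose y x : set W := [set w | truth num x true (lift w) [tuple] = 0].
suff -> : (fun Y : theory L => lift @^-1` Y) @` zone_theories T th =
    y @` coherent T th num.
  move=> unc; have [|g [gF gI]] := perfect_image (coherent_closed (num:=num)) _ unc.
    move=> w; have [n nP] := local_val (num (inl (true, existT _ 0 (lift w, [tuple])))) 0.
    by exists n => x x' a; rewrite /y /= /truth -(nP _ _ a).
  by exists (y \o g) => // b; exists (g b).
apply/seteqP; split=> [_ [_ [M [a [MT [q zq] ->]]] <-]|_ [x cx <-]].
  have [x cx xE] := code_of_model numI MT zq.
  by exists x => //; apply/predeqP => w; rewrite /y /= -xE.
have [M [e [_ MT z01 xE]]] := model_of_code cx.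
exists [set f | rsat (zone th (e 0)) f [tuple]].
  by exists M, (e 0); split=> //; exists (e 1).
by apply/predeqP => w; rewrite /y /= -xE.
Qed.

Theorem countable_model (L : language) (M : structure L) : countable [set: L] ->
  exists2 N : structure L, models N (Th M) & countable [set: N].
Proof.
move=> /countable_index/countable_inj[num numI].
have [a] := carrier_neq0 M.
pose th (i : nat) : formula L 2 := Imp (Bot L 2) (Bot L 2).
have za : zone th a a by move=> i.
have [x cx _] := code_of_model numI (fun f Mf => Mf : Th M f) za.
have [N [e [eS NT _ _]]] := model_of_code cx.
exists N => //; apply: countable_le (countableP [set: nat]).
by apply: (@card_le_surj _ _ _ _ e) => m _; have [k <-] := eS m; exists k.
Qed.

(** * The values of e-spectra *)

Lemma card_theories (L : language) (A : set (theory L)) :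
  countable [set: L] -> (A #<= [set: nat -> bool])%card.
Proof.
move=> cL; have [c cI] : exists c : sentence L -> nat, injective c.
  exact/countable_inj/countable_theory.
apply: (@card_le_inj _ _ _ _ (fun Y k => `[< exists2 f, c f = k & Y f >])) => //.
move=> Y Z _ _ YZ; apply/predeqP => f.
have E (X : theory L) : X f <-> `[< exists2 g, c g = c f & X g >].
  split=> [Xf|/asboolP[g /cI <-] //].
  by apply/asboolP; exists f.
by rewrite E (congr1 (fun h => h (c f)) YZ) -E.
Qed.

Fixpoint liftE (L : language) n (f : formula L n) : formula (langE L) n :=
  match f with
  | Bot => Bot (langE L) _
  | Eq x y => Eq (langE L) x y
  | Rel s xs => @Rel (langE L) _ (Some s) xs
  | Imp f g => Imp (liftE f) (liftE g)
  | All f => All (liftE f)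
  end.

Lemma rsat_liftE (L : language) (M : structure (langE L)) (Q : set M) n
    (f : formula L n) (v : n.-tuple M) :
  rsat (Q : set (reductE M)) f v <-> rsat Q (liftE f) v.
Proof.
elim: f v => {n} //= [n f IHf g IHg|n f IHf] v; first by rewrite IHf IHg.
by split=> H a Qa; apply/IHf; exact: H.
Qed.

Definition classF (L : language) : formula (langE L) 2 :=
  @Rel (langE L) 2 None (ord_tuple 2).

Lemma zone_classE (L : language) (M : structure (langE L)) (a : M) :
  zone (fun=> classF L) a = classE a.
Proof.
apply/predeqP => b.
have E : sat (classF L) [tuple a; b] = @interp (langE L) M None [tuple a; b].
  congr (interp _); apply: (@eq_from_tnth 2) => i.
  by rewrite tnth_map tnth_ord_tuple.
by rewrite /zone /classE /= -E; split=> [/(_ 0)|H _].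
Qed.

Definition all_class_theories (L : language) (T : theory (langE L)) :
    set (theory L) :=
  [set Y | exists2 N : structure (langE L), models N T & class_theories N Y].

Lemma class_theoriesE (L : language) (M : structure (langE L)) (Y : theory L) :
  class_theories M Y <-> exists2 a : M, classE a !=set0 &
    Y = [set f | rsat (classE a) (liftE f) [tuple]].
Proof.
have E (a : M) (a0 : classE a !=set0) :
    Th (@restr L (reductE M) (classE a) a0) =
    [set f | rsat (classE a) (liftE f) [tuple]].
  by rewrite Th_restr; apply/predeqP => f /=; exact: rsat_liftE.
split=> [[a [a0 ->]]|[a a0 ->]]; first by exists a.
by exists a, a0; rewrite E.
Qed.

Lemma all_class_theoriesE (L : language) (T : theory (langE L)) :
  all_class_theories T =
  (fun Y : theory (langE L) => @liftE L 0 @^-1` Y) @` zone_theories T (fun=> classF L).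
Proof.
apply/seteqP; split=> [Y [M MT /class_theoriesE[a a0 ->]]|_ [_ [M [a [MT a0 ->]]] <-]].
  exists [set f | rsat (classE a) f [tuple]] => //.
  by exists M, a; rewrite zone_classE.
exists M => //; apply/class_theoriesE; exists a; first by rewrite -zone_classE.
by rewrite -zone_classE.
Qed.

Section SpectrumE.
Variables (L : language) (M0 : structure (langE L)).

Lemma new_class_theoriesE (M : structure (langE L)) : models M (Th M0) ->
  new_class_theories M = all_class_theories (Th M0) `\` class_theories M.
Proof.
move=> /models_Th eM; apply/seteqP; split=> Y [HY nY]; split=> //.
  have [N [eN YN]] := HY; exists N => //.
  by rewrite /models -eM -eN.
by have [N /models_Th eN YN] := HY; exists N; split=> //; rewrite /elem_equiv eN.
Qed.

(** The bounds on the e-spectra of the models are either all finite and then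
    attained, or have supremum omega. *)
Lemma eSpE_countable : countable (all_class_theories (Th M0)) ->
  exists k, is_eSpE (Th M0) (value_type k).
Proof.
move=> cC.
pose bound n := forall M, models M (Th M0) -> (new_class_theories M #<= `I_n)%card.
case: (pselect (exists n, bound n)) => [bd|unb].
  have bd' : exists n, `[< bound n >] by have [n /asboolP bn] := bd; exists n.
  case: (ex_minnP bd') => n /asboolP bn nmin; exists (Defs.Finite n); split=> [M MT|K' bK].
    by rewrite (card_le_eqr (card_ordinal n)); exact: bn.
  rewrite (card_le_eql (card_ordinal n)).
  case: n bn nmin => [|n] bn nmin.
    by rewrite (_ : `I_0 = set0) ?card_le_emptyl //; apply/seteqP; split.
  have /existsNP[M /not_implyP[MT nM]] : ~ bound n.
    by move=> /asboolP/nmin; rewrite ltnn.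
  have [//|lt] := card_le_or_gt (new_class_theories M) n.
  exact: card_le_trans lt (bK M MT).
exists Omega; split=> [M MT|K' bK].
  apply: card_le_trans cC; apply: subset_card_le.
  by rewrite new_class_theoriesE // => Y [].
apply/infiniteP => /finite_setP[n Kn]; apply: unb; exists n => M MT.
by rewrite -(card_le_eqr Kn); exact: bK.
Qed.

(** A copy of the Cantor space is a union of uncountably many disjoint copies of
    itself, and a countable model has too few classes to meet them all. *)
Lemma eSpE_uncountable : countable [set: langE L] ->
  ~ countable (all_class_theories (Th M0)) ->
  is_eSpE (Th M0) (nat -> bool).
Proof.
move=> cL unc; split=> [M MT|K' bK].
  apply: card_theories; have [c cI] := countable_inj cL.
  by apply: (@inj_countable _ _ (fun s : L => c (Some s))) => s t /cI[].
have [g gI gC] : exists2 g : (nat -> bool) -> theory L, injective g &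
    forall b, all_class_theories (Th M0) (g b).
  by rewrite all_class_theoriesE in unc *; exact: zone_theories_perfect.
have [M MT cM] := countable_model M0 cL.
have cS : countable (class_theories M).
  apply: countable_le cM.
  pose h (a : M) := [set f : sentence L | rsat (classE a) (liftE f) [tuple]].
  by apply: (@card_le_surj _ _ _ _ h) => Y /class_theoriesE[a _ ->]; exists a.
pose pair (b c : nat -> bool) n := if odd n then b n./2 else c n./2.
have pairI b c b' c' : pair b c = pair b' c' -> b = b' /\ c = c'.
  move=> e; split; apply/funext => n.
    by have := congr1 (fun h => h n.*2.+1) e; rewrite /pair /= odd_double /= uphalf_double.
  by have := congr1 (fun h => h n.*2) e; rewrite /pair odd_double doubleK.
(* Otherwise picking a theory of a class of [M] in each copy would make the
   Cantor space countable. *)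
have [b bP] : exists b, forall c, ~ class_theories M (g (pair b c)).
  apply: contrapT => no; apply: uncountable_cantor.
  have /choice[c cP] : forall b, exists c, class_theories M (g (pair b c)).
    move=> b; apply: contrapT => nc; apply: no; exists b => c Hc.
    by apply: nc; exists c.
  apply: countable_le cS.
  apply: (@card_le_inj _ _ _ _ (fun b => g (pair b (c b)))) => [b _|b b' _ _ /gI/pairI[]//].
  exact: cP.
apply: card_le_trans (bK M MT); rewrite new_class_theoriesE //.
apply: (@card_le_inj _ _ _ _ (fun c => g (pair b c))) => [c _|c c' _ _ /gI/pairI[] //].
by split.
Qed.

Theorem eSpE_value : countable (Th M0) ->
  exists k, is_eSpE (Th M0) (value_type k).
Proof.
move=> /countable_Th cL.
case: (pselect (countable (all_class_theories (Th M0)))); first exact: eSpE_countable.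
by move/(eSpE_uncountable cL) => H; exists TwoToOmega.
Qed.

End SpectrumE.

Lemma infty_theories_zone (L : language) (I : Type) (i : nat -> I)
    (T : theory (langP L I)) : (forall j, exists k, i k = j) ->
  infty_theories T =
  zone_theories T (fun k => Neg (@Rel (langP L I) 2 (inr (i k)) [tuple ord_max])).
Proof.
move=> iS; set th := (th in zone_theories _ th).
have zE (M : structure (langP L I)) (a : M) : zone th a = p_infty M.
  apply/predeqP => m; rewrite /zone /p_infty /=.
  have e : map_tuple (tnth [tuple a; m]) [tuple ord_max] = [tuple m] by exact: val_inj.
  split=> H j; last by rewrite e; exact: H.
  by have [k <-] := iS j; have := H k; rewrite e.
apply/seteqP; split=> [_ [M [M0 [MT ->]]]|_ [M [a [MT M0 ->]]]].
  by have [a] := carrier_neq0 M; exists M, a; rewrite zE Th_restr.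
by rewrite zE in M0 *; exists M, M0; rewrite Th_restr.
Qed.

Theorem eSpP_value (L : language) (I : Type) (M0 : structure (langP L I)) :
  inhabited I -> countable (Th M0) ->
  exists k, is_eSpP (Th M0) (value_type k).
Proof.
move=> I0 /countable_Th cL.
have cI : countable [set: I].
  have [c cI] := countable_inj cL.
  by apply: (@inj_countable _ _ (c \o inr)) => i j /cI[].
have [i iS] := surjection_from_nat cI I0.
case: (pselect (countable (infty_theories (Th M0)))) => [/countable_value //|unc].
exists TwoToOmega; apply/card_eqPle; split; first exact: card_theories.
have [|g gI gC] := @zone_theories_perfect _ (Th M0)
    (fun k => Neg (@Rel (langP L I) 2 (inr (i k)) [tuple ord_max])) _ id cL.
  by rewrite image_id -infty_theories_zone.
rewrite image_id -infty_theories_zone // in gC.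
by apply: (@card_le_inj _ _ _ _ g) => [b _|b c _ _ /gI].
Qed.

(** * Realizing the values by E-combinations *)

(** The predicates [(true, j)] carry the bits of a pattern, and the predicates
    [(false, j)] bound the number of its meaningful bits. *)
Definition monadic : language := @Language (bool * nat) (fun=> 1) (fun=> isT).

Definition one_point (p : set monadic) : structure monadic :=
  @Structure monadic unit (inhabits tt) (fun s _ => p s).

Lemma one_point_inj (p q : set monadic) : Th (one_point p) = Th (one_point q) -> p = q.
Proof.
have E (r : set monadic) s :
    Th (one_point r) (All (@Rel monadic 1 s [tuple ord0])) = r s.
  by rewrite /Th /=; apply/propext; split=> [/(_ tt)|].
by move=> e; apply/funext => s; rewrite -E e E.
Qed.

Section Points.
Variables (J : Type) (J0 : inhabited J) (pat : J -> set monadic).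

Definition points : structure (langE monadic) :=
  combE J0 (fun j => one_point (pat j)).

Definition point (j : J) : points := existT _ j tt.

Lemma points_rel s (x : points) :
  @interp (langE monadic) points (Some s) [tuple x] <-> pat (projT1 x) s.
Proof.
case: x => j []; split=> [[i [w [pi e]]]|ps].
  by have := congr1 (fun t => projT1 (thead t)) e; rewrite /thead tnth_map /= => ->.
by exists j, [tuple tt]; split=> //; exact: val_inj.
Qed.

Lemma points_eq (x y : points) :
  @interp (langE monadic) points None [tuple x; y] <-> x = y.
Proof.
rewrite /= /tnth /=; split=> [|-> //].
by case: x y => [i []] [j []] /= ->.
Qed.

End Points.

Definition symbolF (s : monadic) n (i : 'I_n) : formula (langE monadic) n :=
  @Rel (langE monadic) n (Some s) [tuple i].

Definition pattern (M : structure (langE monadic)) (x : M) : set monadic :=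
  [set s | @interp (langE monadic) M (Some s) [tuple x]].

Lemma pattern_points (J : Type) (J0 : inhabited J) (pat : J -> set monadic)
    (x : points J0 pat) : pattern x = pat (projT1 x).
Proof. by apply/predeqP => s; exact: points_rel. Qed.

Fixpoint patternF (p : set monadic) (l : seq monadic) : formula (langE monadic) 1 :=
  match l with
  | [::] => Neg (Bot _ _)
  | s :: l' => And (if `[<p s>] then symbolF s ord0 else Neg (symbolF s ord0))
                   (patternF p l')
  end.

Definition same_on (l : seq (bool * nat)) (p q : set monadic) : Prop :=
  forall s, s \in l -> (p s <-> q s).

Lemma sat_patternF (M : structure (langE monadic)) p l (x : M) :
  sat (patternF p l) [tuple x] <-> same_on l (pattern x) p.
Proof.
have sE s : sat (symbolF s ord0) [tuple x] <-> pattern x s.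
  by rewrite /= map_tuple1.
have litE s : sat (if `[<p s>] then symbolF s ord0 else Neg (symbolF s ord0)) [tuple x]
    <-> (pattern x s <-> p s).
  case: asboolP => ps; first by rewrite sE; split=> [xp|[_ px]]; [split | exact: px].
  rewrite -[sat _ _]/(~ sat (symbolF s ord0) [tuple x]) sE.
  by split=> [nx|[xp _] /xp //]; split.
elim: l => [|s l IH]; first by split=> // _ [].
rewrite sat_And IH litE; split=> [[xs xl] t|H].
  by rewrite inE => /orP[/eqP ->|/xl].
split=> [|t tl]; last by apply: H; rewrite inE tl orbT.
by apply: H; rewrite mem_head.
Qed.

Section ModelsOfPoints.
Variables (J : Type) (J0 : inhabited J) (pat : J -> set monadic).
Variable M : structure (langE monadic).
Hypothesis MT : models M (Th (points J0 pat)).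

(** The existence of a point with a given pattern on finitely many predicates
    is a sentence. *)
Lemma pattern_approx (p : set monadic) l :
  (exists x : M, same_on l (pattern x) p) <-> exists j, same_on l (pat j) p.
Proof.
pose f : sentence (langE monadic) := Ex (patternF p l).
have E (N : structure (langE monadic)) :
    Th N f <-> exists x : N, same_on l (pattern x) p.
  apply: iff_trans (sat_Ex (patternF p l) [tuple]) _.
  have e (a : N) : cons_tuple a [tuple] = [tuple a] by exact: val_inj.
  by split=> -[x] H; exists x; move: H; rewrite e sat_patternF.
rewrite -E (models_Th MT) E; split=> [[x]|[j]] H.
  by exists (projT1 x); rewrite -pattern_points.
by exists (point J0 pat j); rewrite pattern_points.
Qed.

Lemma class_singleton (x y : M) : classE x y <-> x = y.
Proof.
have H1 := @transfer _ _ _ 2 (Imp (@Rel (langE monadic) 2 None [tuple ord0; ord_max])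
  (Eq _ ord0 ord_max)) MT.
have H2 := @transfer _ _ _ 1 (@Rel (langE monadic) 1 None [tuple ord0; ord0]) MT.
have relE (N : structure (langE monadic)) (v : 2.-tuple N) :
    sat (@Rel (langE monadic) 2 None [tuple ord0; ord_max]) v =
    @interp (langE monadic) N None v.
  by rewrite [v in RHS]tuple2_eta; congr (interp _); exact: val_inj.
split=> [cxy|<-].
  have sxy : sat (@Rel (langE monadic) 2 None [tuple ord0; ord_max]) [tuple x; y].
    by rewrite relE.
  apply: (H1 _ [tuple x; y] sxy) => v sv.
  have : sat (@Rel (langE monadic) 2 None [tuple ord0; ord_max]) v by [].
  by rewrite relE {1}[v]tuple2_eta => /points_eq.
have := H2 _ [tuple x]; rewrite (_ : sat _ _ = classE x x); last first.
  by rewrite /classE /=; congr (interp _); exact: val_inj.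
apply=> v; rewrite [v]tuple1_eta /=.
by rewrite (_ : map_tuple _ _ = [tuple thead v; thead v]) ?points_eq //; exact: val_inj.
Qed.

Lemma class_theories_points (Y : theory monadic) :
  class_theories M Y <-> exists x : M, Y = Th (one_point (pattern x)).
Proof.
have E (x : M) (x0 : classE x !=set0) :
    Th (@restr _ (reductE M) (classE x) x0) = Th (one_point (pattern x)).
  have cx : x \in classE x by apply/mem_set/class_singleton.
  have all_x (u : @restr _ (reductE M) (classE x) x0) : u = exist _ x cx.
    case: u => y yx; have/class_singleton e := set_mem yx.
    by apply: eq_exist.
  apply/esym/(iso_Th (h := fun _ : one_point (pattern x) =>
      (exist _ x cx : @restr _ (reductE M) (classE x) x0))).
  - by move=> [] [].
  - by move=> u; exists tt; exact/esym/all_x.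
  - move=> s t _; rewrite [t]tuple1_eta /interp /= /pattern /=.
    by rewrite (_ : map_tuple sval _ = [tuple x]) //; exact: val_inj.
split=> [[x [x0 ->]]|[x ->]]; first by exists x.
have x0 : classE x !=set0 by exists x; exact/class_singleton.
by exists x, x0.
Qed.

End ModelsOfPoints.

Section RealizationE.
Variables (K : Type) (e : K -> nat -> bool).
Hypothesis eI : injective e.
Hypothesis e_closed : forall p : set nat,
  (forall m, exists c, forall j, j < m -> (p j <-> e c j)) ->
  exists c, forall j, p j <-> e c j.

(** A node [Some (c, m)] is the approximation of the limit [c] by its first [m]
    bits; [None] is the approximation by no bit, present even if there is no
    limit. *)
Definition node : Type := option (K * nat).
Definition node_length (i : node) : nat := if i is Some (_, m) then m else 0.
Definition node_bit (i : node) (j : nat) : bool :=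
  if i is Some (c, _) then e c j else false.

(** The predicates [(false, j)] with [j] at least the length hold, so that the
    length can be read on two predicates. *)
Definition node_pattern (i : node) : set monadic := [set s : bool * nat |
  if s.1 then (s.2 < node_length i) && node_bit i s.2 else node_length i <= s.2].

Definition limit_pattern (c : K) : set monadic := [set s : bool * nat |
  if s.1 then e c s.2 else false].

Definition window (m : nat) : seq (bool * nat) :=
  [seq (b, j) | b <- [:: true; false], j <- iota 0 m.+1].

Lemma mem_window m b j : ((b, j) \in window m) = (j <= m).
Proof.
apply/allpairsP/idP => [[p [_ + [_ ->]]]|jm]; first by rewrite mem_iota.
by exists (b, j); rewrite mem_iota; split=> //; case: b.
Qed.

(** The window shows the length of the node and all its bits, and a pattern
    approximated by nodes is determined by these. *)
Lemma node_pattern_isolated i m (p : set monadic) : node_length i <= m ->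
  (forall l, exists i', same_on l (node_pattern i') p) ->
  same_on (window m) (node_pattern i) p -> node_pattern i = p.
Proof.
move=> im ap ip; apply/predeqP => s.
have [i' i'P] := ap (s :: window m).
rewrite -(i'P s) ?mem_head //.
have ii' t : t \in window m -> node_pattern i t <-> node_pattern i' t.
  by move=> tm; rewrite (ip t tm) i'P // inE tm orbT.
have le k : k <= m -> (node_length i <= k) = (node_length i' <= k).
  by move=> km; apply/idP/idP; have := ii' (false, k); rewrite mem_window => /(_ km)[].
have el : node_length i = node_length i'.
  apply/eqP; rewrite eqn_leq; have l1 := le _ im.
  rewrite leqnn in l1; have l2 : node_length i' <= node_length i by [].
  by rewrite l2 le ?leqnn // (leq_trans l2).
case: s {i'P} => b j; case: (leqP j m) => jm.
  by apply: ii'; rewrite mem_window.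
have ij : node_length i <= j by exact: leq_trans (ltnW jm).
by rewrite /node_pattern /= -el [j < _]ltnNge ij; case: b.
Qed.

Let N0 : inhabited node := inhabits None.
Let A := points N0 node_pattern.

(** If some predicate [(false, m)] holds at [x], the length is bounded and [x]
    has the pattern of a node; otherwise nodes of unbounded length approximate
    the pattern of [x], which is a limit because the limits are closed. *)
Lemma pattern_model (M : structure (langE monadic)) (x : M) : models M (Th A) ->
  (exists i, pattern x = node_pattern i) \/ (exists c, pattern x = limit_pattern c).
Proof.
move=> MT; have ap l : exists i, same_on l (node_pattern i) (pattern x).
  by apply/(pattern_approx MT); exists x.
case: (pselect (exists m, pattern x (false, m))) => [[m xm]|no]; [left|right].
  have [i ix] := ap (window m); exists i.
  apply/esym/(node_pattern_isolated _ ap ix); apply/(ix (false, m)) => //.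
  by rewrite mem_window.
have [c cP] : exists c, forall j, pattern x (true, j) <-> e c j.
  apply: (e_closed (p := fun j => pattern x (true, j))) => m.
  have [i ix] := ap (window m).
  have mi : m < node_length i.
    rewrite ltnNge; apply/negP => im; apply: no; exists m.
    by apply/(ix (false, m)) => //; rewrite mem_window.
  case: i ix mi => // -[c k] ix /= mk; exists c => j jm.
  by rewrite -(ix (true, j)) ?mem_window ?(ltnW jm) // /node_pattern /= (ltn_trans jm).
exists c; apply/predeqP => -[[] j]; first exact: cP.
by split=> // H; case: no; exists j.
Qed.

Lemma node_realized (M : structure (langE monadic)) i : models M (Th A) ->
  exists x : M, pattern x = node_pattern i.
Proof.
move=> MT.
have [x xi] : exists x : M, same_on (window (node_length i)) (pattern x) (node_pattern i).
  by apply/(pattern_approx MT); exists i.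
exists x; apply/esym/(node_pattern_isolated (leqnn _)) => [l|s /xi ->] //.
by apply/(pattern_approx MT); exists x.
Qed.

Let J0 : inhabited (node + K) := inhabits (inl None).
Let all_pattern (j : node + K) : set monadic :=
  match j with inl i => node_pattern i | inr c => limit_pattern c end.
Let N := points J0 all_pattern.

(** The limit [c] and a node [Some (c, m)] agree on all the predicates of index
    less than [m]; exchanging them is an automorphism of the reduct. *)
Lemma elementary_limits : Th A = Th N.
Proof.
pose rk (s : langE monadic) : nat := if s is Some s' then s'.2 else 0.
pose inc (x : A) : N := point J0 all_pattern (inl (projT1 x)).
apply: (elementary_of_automorphisms (rk := rk) (h := inc)).
- by move=> [i []] [j []] [->].
- move=> [s|] t _.
    by rewrite [t]tuple1_eta map_tuple1 !points_rel.
  rewrite [t]tuple2_eta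
    (_ : map_tuple _ _ = [tuple inc (tnth t ord0); inc (tnth t ord_max)]);
    last exact: val_inj.
  rewrite !points_eq; split=> [|-> //].
  by case: (tnth t ord0) (tnth t ord_max) => [i []] [j []] [->].
move=> r n v [[i|c] []].
  exists id, (point N0 node_pattern i); split=> // [y|s t _]; first by exists y.
  by rewrite (_ : map_tuple id t = t) //; apply: val_inj; exact: map_id.
(* The node must agree with the limit up to [r] and avoid the tuple [v]. *)
pose m := maxn r (\max_(k < n) node_length (projT1 (tnth v k))).+1.
have patE (s : monadic) : s.2 < m -> limit_pattern c s <-> node_pattern (Some (c, m)) s.
  by case: s => -[] j; rewrite /node_pattern /limit_pattern /= => jm; rewrite ?jm // leqNgt jm.
pose sw := swap (inr c) (inl (Some (c, m)) : node + K).
have swI : injective sw by exact: inv_inj (@swapK _ _ _).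
have swN i : (forall k, i <> Some (c, k)) \/ node_length i < m -> sw (inl i) = inl i.
  by move=> H; apply: swapN => // -[]; case: H => [/(_ m)//|] /[swap] -> /=; rewrite ltnn.
pose move_point (x : N) : N := point J0 all_pattern (sw (projT1 x)).
exists move_point, (point N0 node_pattern (Some (c, m))); split.
- by move=> [i []] [j []] [/swI ->].
- move=> [j []]; exists (point J0 all_pattern (sw j)).
  by rewrite /move_point /= /sw swapK.
- move=> [s|] t rs.
    rewrite [t]tuple1_eta map_tuple1 !points_rel /=.
    have sm : s.2 < m by rewrite leq_max -[_ < r]/(rk (Some s) < r) rs.
    by apply: (@swapP _ _ _ (fun j j' => all_pattern j' s <-> all_pattern j s))
      => //=; rewrite patE.
  rewrite [t]tuple2_eta (_ : map_tuple _ _ =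
    [tuple move_point (tnth t ord0); move_point (tnth t ord_max)]);
    last exact: val_inj.
  rewrite !points_eq; split=> [|-> //].
  by case: (tnth t ord0) (tnth t ord_max) => [i []] [j []] [/swI ->].
- move=> i; rewrite /move_point /= swN //; right.
  by rewrite leq_max ltnS (leq_bigmax i) orbT.
- by rewrite /move_point /= /sw swapL.
Qed.

Lemma limit_new c : new_class_theories A (Th (one_point (limit_pattern c))).
Proof.
split.
  exists N; split; first by rewrite /elem_equiv elementary_limits.
  have NA : models N (Th A) by rewrite /models elementary_limits.
  apply/(class_theories_points NA); exists (point J0 all_pattern (inr c)).
  by rewrite pattern_points.
have AA : models A (Th A) by [].
move/(class_theories_points AA) => [[i []]] /one_point_inj e'.
have := congr1 (fun p : set monadic => p (false, node_length i)) e'.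
rewrite pattern_points /limit_pattern /node_pattern /= leqnn => ft.
by have : is_true false by rewrite ft.
Qed.

Lemma new_limit (M : structure (langE monadic)) Y : models M (Th A) ->
  new_class_theories M Y -> exists c, Y = Th (one_point (limit_pattern c)).
Proof.
move=> MT [[N' [eN YN]] nY].
have N'T : models N' (Th A) by rewrite /models -(models_Th MT) -eN.
have [x xY] := (class_theories_points N'T Y).1 YN; rewrite xY in nY *.
have [[i xi]|[c ->]] := pattern_model x N'T; last by exists c.
have [y yi] := node_realized i MT.
by case: nY; apply/(class_theories_points MT); exists y; rewrite yi -xi.
Qed.

Lemma eSpE_node_points : is_eSpE (Th A) K.
Proof.
split=> [M MT|K' bK].
  apply: (@card_le_surj _ _ _ _ (fun c => Th (one_point (limit_pattern c)))) => Y.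
  by move=> /(new_limit MT)[c ->]; exists c.
apply: card_le_trans (bK A _); last by [].
apply: (@card_le_inj _ _ _ _ (fun c => Th (one_point (limit_pattern c)))) => [c _|c d _ _].
  exact: limit_new.
move=> /one_point_inj E; apply: eI; apply/funext => j.
by apply: is_true_inj; exact: (congr1 (fun p : set monadic => p (true, j)) E).
Qed.

End RealizationE.

Definition closed_family (K : Type) (e : K -> nat -> bool) : Prop :=
  forall p : set nat,
    (forall m, exists c, forall j, j < m -> (p j <-> e c j)) ->
    exists c, forall j, p j <-> e c j.

(** The singletons of numbers together with the empty set form a closed set;
    the shift of the bits by one lets the value 0 stand for the empty set, to
    which the singletons converge. *)
Lemma closed_singletons (K : Type) (v : K -> nat) : injective v ->
  (forall c a, a < v c -> exists c', v c' = a) ->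
  exists2 e : K -> nat -> bool, injective e & closed_family e.
Proof.
move=> vI vseg; pose e c j := v c == j.+1; exists e.
  move=> c d ecd; apply: vI.
  case vc : (v c) => [|a]; last first.
    have := congr1 (fun h => h a) ecd; rewrite /e vc eqxx => /esym/eqP -> //.
  case vd : (v d) => [|a] //.
  by have := congr1 (fun h => h a) ecd; rewrite /e vc vd eqxx.
move=> p ap; case: (pselect (exists j, p j)) => [[j pj]|no].
  have [c cP] := ap j.+1; exists c => i.
  have [d dP] := ap (maxn i j).+1.
  suff <- : d = c by apply: dP; rewrite ltnS leq_maxl.
  apply: vI; have /eqP -> : e d j by apply/(dP j) => //; rewrite ltnS leq_maxr.
  by have /eqP -> : e c j by apply/(cP j).
have [c _] := ap 0.
have [d vd] : exists d, v d = 0.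
  by case vc : (v c) => [|a]; [exists c | apply: (vseg c); rewrite vc].
by exists d => j; rewrite /e vd; split=> // pj; case: no; exists j.
Qed.

Lemma closed_family_value (k : spectrum_value) :
  exists2 e : value_type k -> nat -> bool, injective e & closed_family e.
Proof.
case: k => [n||] /=.
- apply: (@closed_singletons _ (fun i : 'I_n => nat_of_ord i)) => [i j /val_inj //|c a ac].
  by exists (Ordinal (ltn_trans ac (ltn_ord c))).
- by apply: (@closed_singletons _ id) => // c a _; exists a.
exists id => // p _; exists (fun j => `[<p j>]) => j.
by split=> /asboolP.
Qed.

Theorem eSpE_realized (k : spectrum_value) :
  exists (L : language) (I : Type) (I0 : inhabited I) (A : I -> structure L),
    countable (Th (combE I0 A)) /\ is_eSpE (Th (combE I0 A)) (value_type k).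
Proof.
have cL : countable [set: langE monadic].
  exact: (@inj_countable _ _ (fun s : langE monadic => s : option (bool * nat))).
have [e eI e_closed] := closed_family_value k.
exists monadic, (node (value_type k)), (inhabits None), (fun i => one_point (node_pattern e i)).
by split; [exact: countable_theory | exact: eSpE_node_points].
Qed.

(** * Realizing the values by P-combinations *)

(** Any structure whose tuples in relations lie in members of a cover is a
    P-combination of its restrictions to the cover, all taken in the full
    language. *)
Section CoveredStructure.
Variables (L : language) (I U : Type) (i0 : I) (D : I -> set U).
Variable R : interpretation L U.
Hypothesis D_neq0 : forall i, D i !=set0.
Hypothesis D_cover : forall x, exists i, D i x.
Hypothesis R_cover : forall s (t : (arity s).-tuple U), R t ->
  exists i, forall k, D i (tnth t k).

Definition covered_family : Pfamily L I U :=
  @PFamily L I U D (fun=> setT) D_neq0 D_cover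
    (fun s => ex_intro (fun=> True) i0 Logic.I)
    (fun i s w => R (map_tuple sval w)).

Lemma covered_rel s (t : (arity s).-tuple U) :
  @interpP _ _ _ covered_family (inl s) t <-> R t.
Proof.
split=> [[i [si [w [Rw ->]]]] //|Rt].
have [i it] := R_cover Rt.
pose w : (arity s).-tuple (D i) := [tuple exist _ (tnth t k) (mem_set (it k)) | k < arity s].
have wt : map_tuple sval w = t by apply: eq_from_tnth => k; rewrite tnth_map tnth_mktuple.
by exists i, (mem_setT s), w; split; [rewrite /= wt | rewrite wt].
Qed.

Lemma covered_Pcombination : is_Pcombination covered_family.
Proof. by move=> i s si w; rewrite covered_rel. Qed.

End CoveredStructure.

(** The relation [R] is sameness of type for quantifier-free formulas without
    equality; each type is either omitted in both structures or realized
    infinitely often in both. *)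
Lemma back_and_forth (L : language) (M N : structure L) (R : M -> N -> Prop) :
  (forall s (t : (arity s).-tuple M) (u : (arity s).-tuple N),
     (forall i, R (tnth t i) (tnth u i)) -> interp t <-> interp u) ->
  (forall x n (u : n.-tuple N), exists2 y, R x y & forall i, tnth u i <> y) ->
  (forall y n (t : n.-tuple M), exists2 x, R x y & forall i, tnth t i <> x) ->
  Th M = Th N.
Proof.
move=> atoms forth back.
pose iso n (t : n.-tuple M) (u : n.-tuple N) :=
  (forall i, R (tnth t i) (tnth u i)) /\
  (forall i j, tnth t i = tnth t j <-> tnth u i = tnth u j).
have iso_cons n (t : n.-tuple M) (u : n.-tuple N) x y : iso n t u -> R x y ->
    (forall i, x = tnth t i <-> y = tnth u i) ->
    iso n.+1 (cons_tuple x t) (cons_tuple y u).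
  move=> [tuR tuE] xy xyE; split=> [i|i j].
    by case: (unliftP ord0 i) => [i' ->|->]; rewrite ?tnthS ?tnth0.
  case: (unliftP ord0 i) => [i' ->|->]; case: (unliftP ord0 j) => [j' ->|->];
    rewrite ?tnthS ?tnth0 //.
  by split=> /esym/xyE/esym.
suff H n (f : formula L n) t u : iso n t u -> sat f t <-> sat f u.
  by apply/predeqP => f; apply: H; split=> -[].
elim: f t u => {n} /= [n|n i j|n s xs|n f IHf g IHg|n f IHf] t u tu.
- by [].
- exact: tu.2.
- by apply: atoms => i; rewrite !tnth_map; exact: tu.1.
- by rewrite (IHf _ _ tu) (IHg _ _ tu).
split=> [H y|H x].
  case: (pselect (exists i, tnth u i = y)) => [[i iy]|no].
    apply/(IHf (cons_tuple (tnth t i) t)); last exact: H.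
    apply: iso_cons => // [|j]; rewrite -iy; first exact: tu.1.
    exact: tu.2.
  have [x xy xN] := back y _ t; apply/(IHf (cons_tuple x t)); last exact: H.
  apply: iso_cons => // i; split=> [e|e]; first by case: (xN i).
  by case: no; exists i.
case: (pselect (exists i, tnth t i = x)) => [[i ix]|no].
  apply/(IHf _ (cons_tuple (tnth u i) u)); last exact: H.
  apply: iso_cons => // [|j]; rewrite -ix; first exact: tu.1.
  exact: tu.2.
have [y xy yN] := forth x _ u; apply/(IHf _ (cons_tuple y u)); last exact: H.
apply: iso_cons => // i; split=> [e|e]; last by case: (yN i).
by case: no; exists i.
Qed.

(** The symbol [inl c] is the colour [c]. The symbol [inr (oc, j)] is the link
    leading to the point number [j] of colour [oc] in the same block, where
    [None] stands for the absence of colour. *)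
Definition block_arity (s : nat + option nat * nat) : nat :=
  if s is inl _ then 1 else 3.

Lemma block_arity_gt0 s : 0 < block_arity s. Proof. by case: s. Qed.

Definition block_lang : language := Language block_arity_gt0.

(** The block [(l, m)] has the colours generated by [l]; the number [m]
    provides infinitely many copies. *)
Definition block_id : Type := (seq nat * nat)%type.

Definition block_langP : language := langP block_lang (option block_id).

Definition arg0 : 'I_3 := ord0.
Definition arg1 : 'I_3 := lift ord0 ord0.
Definition arg2 : 'I_3 := lift ord0 (lift ord0 ord0).

Section BlockStructure.
Variables (B : Type) (emb : block_id -> B) (ok : B -> set nat).

(** The points of a block [b] are numbered in each colour or absence of colour.
    Colours that are not available in [b] are ignored, which only adds
    uncoloured points. The point [None] is outside all blocks. *)
Definition block_point : Type := option (B * option nat * nat).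

Definition available (b : B) (oc : option nat) : Prop :=
  if oc is Some c then ok b c else True.

Definition colour (c : nat) (x : block_point) : Prop :=
  if x is Some (b, Some c', _) then c' = c /\ ok b c else False.

(** The last argument, necessarily [None], makes the links disappear from any
    restriction to a set without this point. *)
Definition link (oc : option nat) (j : nat) (x y z : block_point) : Prop :=
  match x, y, z with
  | Some (b, _, _), Some (b', oc', j'), None =>
      [/\ b' = b, oc' = oc, j' = j & available b oc]
  | _, _, _ => False
  end.

(** The part [None] contains only the point [None], and [Some i] adds the block
    named [i]; a block outside the range of [emb] lies in no part. *)
Definition part (i : option block_id) (x : block_point) : Prop :=
  match x, i with
  | None, _ => True
  | Some (b, _, _), Some i => b = emb i
  | _, _ => False
  end.

Definition block_rel : interpretation block_lang block_point :=
  fun s => match s return set ((@arity block_lang s).-tuple block_point) with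
  | inl c => fun t : 1.-tuple block_point => colour c (tnth t ord0)
  | inr (oc, j) => fun t : 3.-tuple block_point =>
      link oc j (tnth t arg0) (tnth t arg1) (tnth t arg2)
  end.

Definition block_structure : structure block_langP :=
  @Structure block_langP block_point (inhabits None)
    (fun s => match s return set ((@arity block_langP s).-tuple block_point) with
     | inl s' => @block_rel s'
     | inr i => fun t : 1.-tuple block_point => part i (tnth t ord0)
     end).

End BlockStructure.

Section BlockAtoms.
Variable M : structure block_langP.

Definition coloured (c : nat) (x : M) : Prop :=
  @interp block_langP M (inl (inl c)) [tuple x].
Definition linked (oc : option nat) (j : nat) (x y z : M) : Prop :=
  @interp block_langP M (inl (inr (oc, j))) [tuple x; y; z].
Definition in_part (i : option block_id) (x : M) : Prop :=
  @interp block_langP M (inr i) [tuple x].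

End BlockAtoms.

Section BlockFormulas.
Variable n : nat.
Definition colourF c (i : 'I_n) : formula block_langP n :=
  @Rel block_langP n (inl (inl c)) [tuple i].
Definition linkF oc j (x y z : 'I_n) : formula block_langP n :=
  @Rel block_langP n (inl (inr (oc, j))) [tuple x; y; z].
Definition partF i (x : 'I_n) : formula block_langP n :=
  @Rel block_langP n (inr i) [tuple x].

Variables (M : structure block_langP) (v : n.-tuple M).

Lemma sat_colourF c i : sat (colourF c i) v = coloured c (tnth v i).
Proof. by congr (interp _); exact: val_inj. Qed.
Lemma sat_linkF oc j x y z :
  sat (linkF oc j x y z) v = linked oc j (tnth v x) (tnth v y) (tnth v z).
Proof. by congr (interp _); exact: val_inj. Qed.
Lemma sat_partF i x : sat (partF i x) v = in_part i (tnth v x).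
Proof. by congr (interp _); exact: val_inj. Qed.
Lemma sat_Imp (f g : formula block_langP n) : sat (Imp f g) v = (sat f v -> sat g v).
Proof. by []. Qed.
Lemma sat_Neg (f : formula block_langP n) : sat (Neg f) v = ~ sat f v.
Proof. by []. Qed.
Lemma sat_ExE (f : formula block_langP n.+1) :
  sat (Ex f) v = exists a, sat f (cons_tuple a v).
Proof. by apply/propext; exact: sat_Ex. Qed.

End BlockFormulas.

Definition sat_blockE := (sat_Imp, sat_Neg, sat_ExE, sat_colourF, sat_linkF,
  sat_partF, tnthS, tnth0).

(** First-order properties of block structures, stated semantically; the
    relation [in_part None] plays the role of the point [None]. The relation
    [le] tells which colours a colour forces in its block, and [used] which
    colours occur. *)
Record block_axioms (le : nat -> nat -> Prop) (used : set nat)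
    (M : structure block_langP) : Prop := {
  ax_link_part : forall oc j (x y z : M), linked oc j x y z -> in_part None z;
  ax_link_parts : forall oc j i (x y z : M), linked oc j x y z ->
    in_part i y -> in_part i x;
  ax_link_inj : forall oc j j' (x y z : M), j <> j' ->
    linked oc j x y z -> ~ linked oc j' x y z;
  ax_link_colour : forall c j (x y z : M), linked (Some c) j x y z -> coloured c y;
  ax_link_uncoloured : forall c j (x y z : M), linked None j x y z -> ~ coloured c y;
  ax_colour_uniq : forall c c' (x : M), c <> c' -> coloured c x -> ~ coloured c' x;
  ax_used : forall c (x : M), ~ used c -> ~ coloured c x;
  ax_uncoloured_ex : forall j (x z : M), ~ in_part None x -> in_part None z ->
    exists y, linked None j x y z;
  ax_coloured_ex : forall c c' j (x z : M), le c' c -> coloured c x -> in_part None z ->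
    exists y, linked (Some c') j x y z;
  ax_part_ex : exists z : M, in_part None z }.

Section BlockStructureAtoms.
Variables (B : Type) (emb : block_id -> B) (ok : B -> set nat).
Let N := block_structure emb ok.

Lemma block_colourE c (x : N) : coloured c x = colour ok c x.
Proof. by []. Qed.
Lemma block_linkE oc j (x y z : N) : linked oc j x y z = link ok oc j x y z.
Proof. by []. Qed.
Lemma block_partE i (x : N) : in_part i x = part emb i x.
Proof. by []. Qed.

Definition block_atomE := (block_colourE, block_linkE, block_partE).

Lemma block_axioms_block (le : nat -> nat -> Prop) (used : set nat) :
  (forall b, ok b `<=` used) ->
  (forall b c c', ok b c -> le c' c -> ok b c') ->
  block_axioms le used N.
Proof.
move=> ok_used ok_le; split.
- by move=> oc j x y z; rewrite !block_atomE; case: x y z => [[[b oc'] k]|] [[[b' oc''] k']|] [].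
- move=> oc j i x y z; rewrite !block_atomE.
  by case: x y z => [[[b oc'] k]|] [[[b' oc''] k']|] [] //= [-> _ _ _].
- move=> oc j j' x y z jj'; rewrite !block_atomE.
  case: x y z => [[[b oc'] k]|] [[[b' oc''] k']|] [] //= [_ _ e _] [_ _ e' _].
  by apply: jj'; rewrite -e -e'.
- move=> c j x y z; rewrite !block_atomE.
  by case: x y z => [[[b oc'] k]|] [[[b' oc''] k']|] [] //= [-> -> _ okc].
- move=> c j x y z; rewrite !block_atomE.
  by case: x y z => [[[b oc'] k]|] [[[b' oc''] k']|] [] //= [-> -> _ _].
- move=> c c' x cc'; rewrite !block_atomE.
  by case: x => [[[b [d|]] k]|] //= [dc _] [dc' _]; apply: cc'; rewrite -dc.
- by move=> c x nu; rewrite block_colourE; case: x => [[[b [d|]] k]|] //= [_ /ok_used].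
- move=> j x z; rewrite !block_atomE; case: x z => [[[b oc] k]|] [[[b' oc'] k']|] //= np _.
    by exists (Some (b, None, j)).
- move=> c c' j x z lec; rewrite !block_atomE.
  case: x z => [[[b [d|]] k]|] [[[b' oc'] k']|] //= [dc okc] _.
  by exists (Some (b, Some c', j)); split=> //=; exact: ok_le lec.
- by exists None.
Qed.

End BlockStructureAtoms.

Lemma block_axioms_models le used (M N : structure block_langP) :
  models N (Th M) -> block_axioms le used M -> block_axioms le used N.
Proof.
move=> NT [a1 a2 a3 a4 a5 a6 a7 a8 a9 a10].
have tr n (f : formula block_langP n) :
  (forall v : n.-tuple M, sat f v) -> forall v : n.-tuple N, sat f v by exact: transfer.
pose x3 : 'I_3 := arg0; pose y3 : 'I_3 := arg1; pose z3 : 'I_3 := arg2.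
split.
- move=> oc j x y z.
  have := @tr 3 (Imp (linkF oc j x3 y3 z3) (partF None z3)).
  move=> /(_ _ [tuple x; y; z]); rewrite !sat_blockE; apply=> v.
  by rewrite !sat_blockE; exact: a1.
- move=> oc j i x y z.
  have := @tr 3 (Imp (linkF oc j x3 y3 z3) (Imp (partF i y3) (partF i x3))).
  move=> /(_ _ [tuple x; y; z]); rewrite !sat_blockE; apply=> v.
  by rewrite !sat_blockE; exact: a2.
- move=> oc j j' x y z jj'.
  have := @tr 3 (Imp (linkF oc j x3 y3 z3) (Neg (linkF oc j' x3 y3 z3))).
  move=> /(_ _ [tuple x; y; z]); rewrite !sat_blockE; apply=> v.
  by rewrite !sat_blockE; exact: a3.
- move=> c j x y z.
  have := @tr 3 (Imp (linkF (Some c) j x3 y3 z3) (colourF c y3)).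
  move=> /(_ _ [tuple x; y; z]); rewrite !sat_blockE; apply=> v.
  by rewrite !sat_blockE; exact: a4.
- move=> c j x y z.
  have := @tr 3 (Imp (linkF None j x3 y3 z3) (Neg (colourF c y3))).
  move=> /(_ _ [tuple x; y; z]); rewrite !sat_blockE; apply=> v.
  by rewrite !sat_blockE; exact: a5.
- move=> c c' x cc'.
  have := @tr 1 (Imp (colourF c ord0) (Neg (colourF c' ord0))).
  move=> /(_ _ [tuple x]); rewrite !sat_blockE; apply=> v.
  by rewrite !sat_blockE; exact: a6.
- move=> c x nu.
  have := @tr 1 (Neg (colourF c ord0)).
  move=> /(_ _ [tuple x]); rewrite !sat_blockE; apply=> v.
  by rewrite !sat_blockE; exact: a7.
- move=> j x z.
  have := @tr 3 (Imp (Neg (partF None x3)) (Imp (partF None z3)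
    (Ex (linkF None j (lift ord0 x3) ord0 (lift ord0 z3))))).
  move=> /(_ _ [tuple x; x; z]); rewrite !sat_blockE => H np pz.
  have [|y] := H _ np pz.
    move=> v; rewrite !sat_blockE => nx zx; have [y xy] := a8 j _ _ nx zx.
    by exists y; rewrite !sat_blockE.
  by rewrite !sat_blockE; exists y.
- move=> c c' j x z lec.
  have := @tr 3 (Imp (colourF c x3) (Imp (partF None z3)
    (Ex (linkF (Some c') j (lift ord0 x3) ord0 (lift ord0 z3))))).
  move=> /(_ _ [tuple x; x; z]); rewrite !sat_blockE => H np pz.
  have [|y] := H _ np pz.
    move=> v; rewrite !sat_blockE => xc zx; have [y xy] := a9 _ _ j _ _ lec xc zx.
    by exists y; rewrite !sat_blockE.
  by rewrite !sat_blockE; exists y.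
have := @tr 0 (Ex (partF None ord0)) _ [tuple]; rewrite sat_blockE => -[|z].
  by move=> v; rewrite sat_blockE; case: a10 => z pz; exists z; rewrite !sat_blockE.
by rewrite !sat_blockE; exists z.
Qed.

Definition infty_colours (M : structure block_langP) : set nat :=
  [set c | exists2 x : M, p_infty M x & coloured c x].

Section InftyTheory.
Variables (le : nat -> nat -> Prop) (used : set nat).
Hypothesis le_refl : forall c, le c c.

(** A realization [x] of p_infty is linked to infinitely many points of colour
    [oc], and these lie in no part since a part containing the end of a link
    contains its origin. *)
Lemma infty_links (M : structure block_langP) oc (x : M) :
  block_axioms le used M -> p_infty M x ->
  (forall c, oc = Some c -> exists2 d, le c d & coloured d x) ->
  exists y : nat -> M, [/\ injective y, forall j, p_infty M (y j) &
    forall j c, coloured c (y j) <-> oc = Some c].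
Proof.
move=> ax px ocx; have [z pz] := ax_part_ex ax.
have /choice[y yP] : forall j, exists y, linked oc j x y z.
  move=> j; case: oc ocx => [c|] ocx.
    by have [d cd xd] := ocx c erefl; exact: (ax_coloured_ex ax) cd xd pz.
  exact: (ax_uncoloured_ex ax) (px None) pz.
exists y; split=> [j k e|j i|j c].
- apply: contrapT => jk; have := yP k; rewrite -e.
  exact: (ax_link_inj ax) jk (yP j).
- by move=> yi; apply: (px i); exact: (ax_link_parts ax) (yP j) yi.
split=> [yc|e]; last by have := yP j; rewrite e; exact: (ax_link_colour ax).
case: oc yP {ocx} => [d|] yP; last by case: (ax_link_uncoloured ax (yP j) yc).
congr Some; apply: contrapT => dc.
exact: (ax_colour_uniq ax) dc ((ax_link_colour ax) _ _ _ _ _ (yP j)) yc.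
Qed.

Lemma infty_colour_match (M N : structure block_langP) (x : M) n (u : n.-tuple N) :
  block_axioms le used M -> block_axioms le used N ->
  p_infty M x -> p_infty N !=set0 -> infty_colours M `<=` infty_colours N ->
  exists y : N, [/\ p_infty N y, forall c, coloured c x <-> coloured c y &
    forall i, tnth u i <> y].
Proof.
move=> axM axN px [y0 py0] MN.
have [oc [ocx [y1 [py1 ocy]]]] : exists oc, (forall c, coloured c x <-> oc = Some c) /\
    exists y : N, p_infty N y /\
      (forall c, oc = Some c -> exists2 d, le c d & coloured d y).
  case: (pselect (exists c, coloured c x)) => [[c xc]|no]; last first.
    exists None; split=> [c|]; last by exists y0.
    by split=> // xc; case: no; exists c.
  exists (Some c); split=> [d|].
    split=> [xd|[<-] //]; congr Some; apply: contrapT => cd.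
    exact: (ax_colour_uniq axM) cd xc xd.
  have [y py yc] : infty_colours N c by apply: MN; exists x.
  by exists y; split=> // _ [<-]; exists c.
have [y [yI yp yc]] := infty_links axN py1 ocy.
have [j uj] := injective_avoids u yI.
by exists (y j); split=> // c; rewrite ocx yc.
Qed.

(** Every colour of the relativized structure occurs infinitely often, and the
    links and parts are empty there; so back and forth applies to sameness of
    colour. *)
Lemma infty_Th (M N : structure block_langP)
    (M0 : p_infty M !=set0) (N0 : p_infty N !=set0) :
  block_axioms le used M -> block_axioms le used N ->
  infty_colours M = infty_colours N -> Th (restr M0) = Th (restr N0).
Proof.
move=> axM axN MN.
pose R (x : restr M0) (y : restr N0) :=
  forall c, coloured c (sval x) <-> coloured c (sval y).
have forth (P Q : structure block_langP) (P0 : p_infty P !=set0)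
    (Q0 : p_infty Q !=set0) : block_axioms le used P -> block_axioms le used Q ->
    infty_colours P = infty_colours Q ->
    forall (x : restr P0) n (u : n.-tuple (restr Q0)),
    exists2 y : restr Q0, forall c, coloured c (sval x) <-> coloured c (sval y) &
      forall i, tnth u i <> y.
  move=> axP axQ PQ x n u.
  have sub : infty_colours P `<=` infty_colours Q by rewrite PQ.
  have [y [py xy uy]] :=
    infty_colour_match (map_tuple sval u) axP axQ (set_mem (svalP x)) Q0 sub.
  exists (exist _ y (mem_set py)) => // i e.
  by apply: (uy i); rewrite tnth_map e.
apply: (back_and_forth (R := R)); last 2 first.
- exact: forth.
- move=> y n t; have [x xy tx] := forth _ _ N0 M0 axN axM (esym MN) y n t.
  by exists x => // c; rewrite xy.
have noP (P : structure block_langP) (P0 : p_infty P !=set0) i (t : 1.-tuple (restr P0)) :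
    ~ @interp block_langP (restr P0) (inr i) t.
  rewrite [t]tuple1_eta /= (_ : map_tuple sval _ = [tuple sval (thead t)]); last exact: val_inj.
  exact: (set_mem (svalP (thead t))).
have noL (P : structure block_langP) (P0 : p_infty P !=set0) oc j
    (t : 3.-tuple (restr P0)) : block_axioms le used P ->
    ~ @interp block_langP (restr P0) (inl (inr (oc, j))) t.
  move=> axP; rewrite /= => tj; apply: (set_mem (svalP (tnth t arg2)) None).
  apply: (ax_link_part axP) (_ : linked oc j (sval (tnth t arg0)) (sval (tnth t arg1)) _).
  rewrite /linked; move: tj; congr (interp _); apply: eq_from_tnth.
  by case=> -[|[|[|]]] // lt; rewrite tnth_map; congr (sval (tnth t _)); apply: val_inj.
have cE (P : structure block_langP) (P0 : p_infty P !=set0) c (t : 1.-tuple (restr P0)) :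
    @interp block_langP (restr P0) (inl (inl c)) t = coloured c (sval (tnth t ord0)).
  by rewrite {1}[t]tuple1_eta /coloured /=; congr (interp _); exact: val_inj.
move=> [[c|[oc j]]|i] t u tu.
- by rewrite !cE; exact: tu.
- by split=> H; [case: (noL _ _ _ _ _ axM H) | case: (noL _ _ _ _ _ axN H)].
- by split=> H; [case: (noP _ _ _ _ H) | case: (noP _ _ _ _ H)].
Qed.

End InftyTheory.

Lemma ex_colour_infty (M : structure block_langP) (M0 : p_infty M !=set0) c :
  Th (restr M0) (Ex (colourF c ord0)) <-> infty_colours M c.
Proof.
apply: iff_trans (sat_Ex _ _) _; split=> [[x]|[x px xc]].
  by rewrite sat_colourF => xc; exists (sval x); [exact: set_mem (svalP x)|];
     move: xc; rewrite /coloured /= map_tuple1.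
by exists (exist _ x (mem_set px)); rewrite sat_colourF /coloured /= map_tuple1.
Qed.

Section RealizationP.
Variables (le : nat -> nat -> Prop) (used : set nat).
Hypothesis le_refl : forall c, le c c.
Hypothesis le_trans : forall b a c, le a b -> le b c -> le a c.
Hypothesis used_le : forall c c', used c -> le c' c -> used c'.

(** These are the possible sets of colours of realizations of p_infty. *)
Definition ideal (S : set nat) : Prop :=
  S `<=` used /\ forall c c', S c -> le c' c -> S c'.

Definition span (i : block_id) : set nat :=
  [set c | exists c', [/\ c' \in i.1, used c' & le c c']].

Lemma ideal_span i : ideal (span i).
Proof.
split=> [c [c' [_ uc' cc']]|c c' [d [di ud cd]] cc'].
  exact: used_le uc' cc'.
by exists d; split=> //; exact: le_trans cd.
Qed.

Definition base : structure block_langP := block_structure id span.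

(** The extension has one more block, [None], lying in no part, with [S] as its
    set of colours. *)
Definition extended_colours (S : set nat) (b : option block_id) : set nat :=
  if b is Some i then span i else S.

Definition extended (S : set nat) : structure block_langP :=
  block_structure Some (extended_colours S).

(** A finite part of an ideal generates a smaller ideal with the same elements
    below [r]; so the blocks of [base] approximate every ideal. *)
Lemma span_approx S r m : ideal S -> exists l, forall c, c < r ->
  S c <-> span (l, m) c.
Proof.
move=> [Su Sle]; exists [seq c <- iota 0 r | `[<S c>]] => c cr.
split=> [Sc|[d [/=]]].
  exists c; split=> //; last exact: Su.
  by rewrite mem_filter mem_iota /= cr andbT; apply/asboolP.
by rewrite mem_filter => /andP[/asboolP Sd _] _ /(Sle _ _ Sd).
Qed.

Section Extension.
Variable S : set nat.
Hypothesis idS : ideal S.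
Let N := extended S.

Let inc (x : base) : N :=
  if x is Some (b, oc, j) then Some (Some b, oc, j) else None.

Let move_block (h : option block_id -> option block_id) (x : N) : N :=
  if x is Some (b, oc, j) then Some (h b, oc, j) else None.

Let rk (s : block_langP) : nat :=
  match s with
  | inl (inl c) | inl (inr (Some c, _)) => c
  | inl (inr (None, _)) => 0
  | inr i => pickle i
  end.

Let blockid (x : base) : option block_id :=
  if x is Some (b, _, _) then Some b else None.

Lemma inc_inj : injective inc.
Proof. by move=> [[[b oc] j]|] [[[b' oc'] j']|] //= [-> -> ->]. Qed.

Lemma inc_preserves : preserves setT inc.
Proof.
move=> [[c|[oc j]]|i] t _ /=; rewrite !tnth_map.
- by case: (tnth t ord0) => [[[b [d|]] j]|].
- case: (tnth t arg0) (tnth t arg1) (tnth t arg2)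
    => [[[b oc'] k]|] [[[b' oc''] k']|] [[[b'' oc'''] k'']|] //=.
  by split=> -[e -> -> av]; split=> //; [case: e | rewrite e].
- by move: (tnth t ord0) => x {t}; case: x i => [[[b oc] j]|] [i|] //=; split=> [[]|->].
Qed.

(** The symbols of rank less than [r] see neither the name of the block [(l, m)]
    nor the difference between its colours and [S]. *)
Lemma move_block_preserves r l m : (forall c, c < r -> S c <-> span (l, m) c) ->
  r <= pickle (Some (l, m)) ->
  preserves [set s | rk s < r] (move_block (swap None (Some (l, m)))).
Proof.
move=> SE rm; set sw := swap _ _.
have swI : injective sw by exact: inv_inj (@swapK _ _ _).
have okE c b : c < r -> extended_colours S (sw b) c <-> extended_colours S b c.
  move=> cr; apply: (@swapP _ _ _
    (fun b b' => extended_colours S b' c <-> extended_colours S b c)) => //=.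
    by rewrite SE.
  by rewrite SE.
have avE oc j b : rk (inl (inr (oc, j))) < r ->
    available (extended_colours S) (sw b) oc <-> available (extended_colours S) b oc.
  by case: oc => [c|] //= cr; exact: okE.
move=> [[c|[oc j]]|i] t lt; rewrite /= !tnth_map.
- case: (tnth t ord0) => [[[b [d|]] j]|] //=.
  by rewrite okE.
- case: (tnth t arg0) (tnth t arg1) (tnth t arg2)
    => [[[b oc'] k]|] [[[b' oc''] k']|] [[[b'' oc'''] k'']|] //=.
  by split=> -[e -> -> av]; split=> //;
    [exact: swI | exact/(avE _ _ _ lt) | rewrite e | exact/(avE _ _ _ lt)].
- move: (tnth t ord0) => x {t}; case: x i lt => [[[b oc] j]|] [i|] //= lt.
  apply: (@swapP _ _ _ (fun b b' => b' = Some i <-> b = Some i)) => //.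
    split=> // -[ei]; move: lt; rewrite -ei ltnNge.
    by rewrite rm.
  by split=> // -[ei]; move: lt; rewrite -ei ltnNge rm.
Qed.

Lemma Th_extended : Th base = Th N.
Proof.
apply: (elementary_of_automorphisms (rk := rk) inc_inj inc_preserves) => r n v.
have idg : preserves [set s | rk s < r] (id : N -> N).
  by move=> s t _; rewrite (_ : map_tuple id t = t) //; apply: val_inj; exact: map_id.
case=> [[[[b|] oc] j]|].
- by exists id, (Some (b, oc, j)); split=> // y; exists y.
(* The copy number [m] is chosen so that the name of the block has rank at least
   [r] and exceeds the names of the blocks met by [v]. *)
- pose r' := maxn r (\max_(k < n) pickle (blockid (tnth v k))).+1.
  have [l lS] : exists l, forall c, c < r -> S c <-> span (l, 0) c by exact: span_approx.
  have [m mr] : exists m, r' <= pickle (Some (l, m) : option block_id).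
    by apply: injective_unbounded => m m' /(pcan_inj pickleK)[].
  exists (move_block (swap None (Some (l, m)))), (Some ((l, m), oc, j)); split.
  + move=> [[[b oc'] k]|] [[[b' oc''] k']|] //= [e -> ->].
    by rewrite (inv_inj (@swapK _ _ _) e).
  + move=> y; exists (move_block (swap None (Some (l, m))) y).
    by case: y => [[[b oc'] k]|] //=; rewrite swapK.
  + by apply: move_block_preserves => //; apply: leq_trans mr; exact: leq_maxl.
  + move=> i; case vi : (tnth v i) => [[[b oc'] k]|] //=.
    rewrite swapN // => -[e].
    have := leq_bigmax (F := fun k => pickle (blockid (tnth v k))) i.
    rewrite vi /= e leqNgt => /negP; apply.
    by apply: leq_trans mr; exact: leq_maxr.
  + by rewrite /= swapL.
by exists id, None; split=> // y; exists y.
Qed.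

Lemma extended_axioms : block_axioms le used N.
Proof.
apply: block_axioms_block => [[i|] c|[i|] c c'] /=.
- exact: (ideal_span i).1.
- exact: idS.1.
- exact: (ideal_span i).2.
- exact: idS.2.
Qed.

Lemma p_infty_extended : p_infty N (Some (None, None, 0)).
Proof. by case. Qed.

Lemma infty_colours_extended : infty_colours N = S.
Proof.
apply/seteqP; split=> [c [[[[b [d|]] j]|] px]|c Sc].
- rewrite block_colourE /= => -[<-]; case: b px => // i px.
  by case: (px (Some i)).
- by rewrite block_colourE.
- by rewrite block_colourE.
exists (Some (None, Some c, 0)); first by case.
by rewrite block_colourE.
Qed.

End Extension.

Lemma base_axioms : block_axioms le used base.
Proof.
by apply: block_axioms_block => [i c|i c c']; [exact: (ideal_span i).1 | exact: (ideal_span i).2].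
Qed.

Lemma ideal_infty_colours (M : structure block_langP) :
  block_axioms le used M -> ideal (infty_colours M).
Proof.
move=> ax; split=> [c [x px xc]|c c' [x px xc] cc'].
  by apply: contrapT => nu; exact: (ax_used ax nu) xc.
have [|y [_ py yc]] := @infty_links le used M (Some c') x ax px.
  by move=> _ [<-]; exists c.
by exists (y 0); [exact: py | apply/yc].
Qed.

Let extended0 S : p_infty (extended S) !=set0.
Proof. by exists (Some (None, None, 0)); exact: p_infty_extended. Qed.

Lemma infty_theories_base : (infty_theories (Th base) #= ideal)%card.
Proof.
pose t S := Th (restr (extended0 S)).
have -> : infty_theories (Th base) = t @` ideal.
  apply/seteqP; split=> [_ [M [M0 [MT ->]]]|_ [S idS <-]].
    have axM := block_axioms_models MT base_axioms.
    have idM := ideal_infty_colours axM.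
    exists (infty_colours M) => //; apply: infty_Th (extended_axioms idM) axM _ => //.
    exact: infty_colours_extended.
  exists (extended S), (extended0 S); split=> //.
  by rewrite /models (Th_extended idS).
apply: inj_card_eq => S S' _ _ tSS'.
rewrite -(infty_colours_extended S) -(infty_colours_extended S').
by apply/predeqP => c; rewrite -!(ex_colour_infty (extended0 _)) -/(t S) -/(t S') tSS'.
Qed.

Let part_neq0 i : part (id : block_id -> block_id) i !=set0.
Proof. by exists None. Qed.

Let part_cover (x : block_point block_id) : exists i, part id i x.
Proof. by case: x => [[[b oc] j]|]; [exists (Some b) | exists None]. Qed.

Let rel_cover (s : block_lang) (t : (arity s).-tuple (block_point block_id)) :
  block_rel span t -> exists i, forall k, part id i (tnth t k).
Proof.
case: s t => [c|[oc j]] t /=.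
  case E : (tnth t ord0) => [[[b oc] j]|] // _.
  by exists (Some b) => k; rewrite ord1 E.
move=> lt; suff [i [i0 i1 i2]] : exists i, [/\ part id i (tnth t arg0),
    part id i (tnth t arg1) & part id i (tnth t arg2)].
  exists i => -[[|[|[|//]]] k3].
  - by rewrite (_ : Ordinal k3 = arg0) //; exact: val_inj.
  - by rewrite (_ : Ordinal k3 = arg1) //; exact: val_inj.
  - by rewrite (_ : Ordinal k3 = arg2) //; exact: val_inj.
case: (tnth t arg0) (tnth t arg1) (tnth t arg2) lt
  => [[[b oc'] k]|] [[[b' oc''] k']|] [[[b'' oc'''] k'']|] //= [-> _ _ _].
by exists (Some b).
Qed.

Definition block_family :
    Pfamily block_lang (option block_id) (block_point block_id) :=
  covered_family None (block_rel span) part_neq0 part_cover.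

Lemma block_family_Pcombination : is_Pcombination block_family.
Proof. exact: covered_Pcombination rel_cover. Qed.

Lemma Th_block_family : Th (combP (inhabits None) block_family) = Th base.
Proof.
apply: (@iso_Th block_langP (combP (inhabits None) block_family) base
  (fun x => x)) => // [y|]; first by exists y.
move=> s t _; have -> : map_tuple (fun x => x) t = t.
  by apply: val_inj; exact: map_id.
case: s t => [s|i] t //.
by apply: iff_sym; exact: covered_rel.
Qed.

End RealizationP.

Lemma eSpP_realized_ideals (le : nat -> nat -> Prop) (used : set nat) (K : Type)
    (f : K -> set nat) :
  (forall c, le c c) -> (forall b a c, le a b -> le b c -> le a c) ->
  (forall c c', used c -> le c' c -> used c') ->
  injective f -> (forall S, ideal le used S <-> exists k, f k = S) ->
  exists (L : language) (I U : Type) (I0 : inhabited I) (A : Pfamily L I U),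
    is_Pcombination A /\ countable (Th (combP I0 A)) /\
    is_eSpP (Th (combP I0 A)) K.
Proof.
move=> le_refl le_trans used_le fI fE.
exists block_lang, (option block_id), (block_point block_id), (inhabits None),
  (block_family le used).
split; first exact: block_family_Pcombination.
rewrite Th_block_family; split.
  apply: countable_theory.
  exact: (@inj_countable _ _ (fun s : block_langP =>
    s : nat + option nat * nat + option block_id)).
rewrite /is_eSpP (card_eql (infty_theories_base le_refl le_trans used_le)).
have -> : ideal le used = f @` setT.
  apply/seteqP; split=> S; first by move=> /fE[k <-]; exists k.
  by move=> [k _ <-]; apply/fE; exists k.
by apply: inj_card_eq => k k' _ _; exact: fI.
Qed.

Lemma down_closed_initial (S : set nat) :
  (forall c c', S c -> c' <= c -> S c') -> S = setT \/ exists a, S = `I_a.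
Proof.
move=> Sle; case: (pselect (exists a, ~ S a)) => [[a0 na0]|all]; [right|left].
  have ex : exists a, `[< ~ S a >] by exists a0; apply/asboolP.
  case: (ex_minnP ex) => a /asboolP na amin; exists a.
  apply/predeqP => c; split=> [Sc|/= ca].
    by rewrite /= ltnNge; apply/negP => /(Sle _ _ Sc).
  apply: contrapT => nc; have /amin : `[< ~ S c >] by apply/asboolP.
  by rewrite leqNgt ca.
apply/seteqP; split=> // c _; apply: contrapT => nc; apply: all; by exists c.
Qed.

(** With [m] linearly ordered colours there are [m.+1] ideals; the natural
    numbers with their ordering have countably many ideals, and with the trivial
    ordering all the sets of colours are ideals. The value 0 is that of a single
    part covering everything. *)
Theorem eSpP_realized (k : spectrum_value) :
  exists (L : language) (I U : Type) (I0 : inhabited I) (A : Pfamily L I U),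
    is_Pcombination A /\ countable (Th (combP I0 A)) /\
    is_eSpP (Th (combP I0 A)) (value_type k).
Proof.
case: k => [[|m]||].
- have D0 (i : unit) : [set: unit] !=set0 by exists tt.
  have Dc (x : unit) : exists i : unit, [set: unit] x by exists tt.
  pose A := covered_family tt (fun (s : block_lang) (_ : (arity s).-tuple unit) => False) D0 Dc.
  exists block_lang, unit, unit, (inhabits tt), A; split; first exact: covered_Pcombination.
  split.
    apply: countable_theory.
    exact: (@inj_countable _ _ (fun s : langP block_lang unit =>
      s : nat + option nat * nat + unit)).
  rewrite /is_eSpP (_ : infty_theories _ = set0).
    rewrite card_eq_sym (card_eql (card_ordinal 0)) (_ : `I_0 = set0) ?card_eq00 //.
    by apply/seteqP; split.
  rewrite -subset0 => Y [M [M0 [MT _]]] /=; have [x px] := M0; apply: (px tt).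
  pose f : formula (langP block_lang unit) 1 :=
    @Rel (langP block_lang unit) 1 (inr tt) [tuple ord0].
  have /(_ [tuple x]) : forall v : 1.-tuple M, sat f v by apply: (transfer MT).
  by rewrite /= map_tuple1.
- apply: (@eSpP_realized_ideals leq `I_m _ (fun i : 'I_m.+1 => `I_i)) => //.
  + by move=> b a c ab bc; exact: leq_trans bc.
  + by move=> c c' /= cm /leq_ltn_trans; apply.
  + by move=> i j /initial_segment_inj/val_inj.
  move=> S; split=> [[Su Sle]|[i <-]].
    have [ST|[a Sa]] := down_closed_initial Sle.
      have /Su /= : S m by rewrite ST.
      by rewrite ltnn.
    have am : a < m.+1.
      rewrite ltnS leqNgt; apply/negP => ma.
      have /Su /= : S m by rewrite Sa.
      by rewrite ltnn.
    by exists (Ordinal am); rewrite Sa.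
  split=> [c /= ci|c c' /= ci /leq_ltn_trans]; last exact.
  by rewrite (leq_trans ci) // -ltnS.
- apply: (@eSpP_realized_ideals leq setT _ (fun a => if a is a'.+1 then `I_a' else setT)) => //.
  + by move=> b a c ab bc; exact: leq_trans bc.
  + have IT a : `I_a <> setT.
      by move=> e; have : [set: nat] a by []; rewrite -e /= ltnn.
    move=> [|a] [|b] //; [by move/esym/IT | by move/IT | by move=> /initial_segment_inj ->].
  move=> S; split=> [[_ Sle]|[[|a] <-]].
  + have [ST|[a Sa]] := down_closed_initial Sle; first by exists 0.
    by exists a.+1.
  + by [].
  + by split=> // c c' /= ca /leq_ltn_trans; apply.
apply: (@eSpP_realized_ideals eq setT _ (fun (b : nat -> bool) => [set c | b c])) => //.
- by move=> b a c -> ->.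
- move=> b b' e; apply/funext => c; apply: is_true_inj.
  exact: (congr1 (fun h : set nat => h c) e).
move=> S; split=> [_|_]; last by split=> // c c' Sc ->.
exists (fun c => `[<S c>]); apply/predeqP => c /=.
by split=> /asboolP.
Qed.

Theorem theorem4p14 :
  (forall (L : language) (I : Type) (I0 : inhabited I) (A : I -> structure L),
     countable (Th (combE I0 A)) ->
     exists k : spectrum_value, is_eSpE (Th (combE I0 A)) (value_type k))
  /\
  (forall (L : language) (I U : Type) (I0 : inhabited I) (A : Pfamily L I U),
     is_Pcombination A ->
     countable (Th (combP I0 A)) ->
     exists k : spectrum_value, is_eSpP (Th (combP I0 A)) (value_type k))
  /\
  (forall k : spectrum_value,
     exists (L : language) (I : Type) (I0 : inhabited I) (A : I -> structure L),
       countable (Th (combE I0 A)) /\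
       is_eSpE (Th (combE I0 A)) (value_type k))
  /\
  (forall k : spectrum_value,
     exists (L : language) (I U : Type) (I0 : inhabited I) (A : Pfamily L I U),
       is_Pcombination A /\
       countable (Th (combP I0 A)) /\
       is_eSpP (Th (combP I0 A)) (value_type k)).
Proof.
split=> [L I I0 A|]; first exact: eSpE_value.
split=> [L I U I0 A _|]; first exact: eSpP_value.
by split; [exact: eSpE_realized | exact: eSpP_realized].
Qed.
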